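(* Let $p$ be a prime, let $a$ be an integer not divisible by $p$ and let $F$ be a natural number divisible by $p$. Define $r$ by $|F|_p=p^{-r}$. Suppose that $$\log F+\sum_{q\mid F}\frac{\log q}{q-1}+2<2r\log p+2\,\frac{\log p}{p-1},$$ where the sum is over all primes $q$ dividing $F$. Then the $p$-adic number $R_p(a/F)$ is irrational, i.e. $R_p(a/F)\in\mathbb{Q}_p\setminus\mathbb{Q}$.
   Context: The Bernoulli numbers $B_n$ are defined by $\frac{t}{e^t-1}=\sum_{n\ge0}B_n\frac{t^n}{n!}$. For a prime $p$, an integer $a$ with $p\nmid a$ and a positive integer $F$ with $p\mid F$, the $p$-adic number $R_p(a/F)$ is the sum of the $p$-adically convergent series $$R_p(a/F)=\sum_{n\ge0}B_n\left(-\frac{F}{a}\right)^{n+1}\in\mathbb{Q}_p .$$ $|\cdot|_p$ is the $p$-adic absolute value normalized by $|p|_p=1/p$. *)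

(* Defs.v *)
From HB Require Import structures.
From mathcomp Require Import all_boot all_order all_algebra.
From mathcomp Require Import generic_quotient ring_quotient.
From mathcomp Require Import all_classical all_reals all_analysis.
From mathcomp Require Import ring lra zify.

Set Implicit Arguments.
Unset Strict Implicit.
Unset Printing Implicit Defensive.

Import Order.TTheory GRing.Theory Num.Theory.

Local Open Scope classical_set_scope.
Local Open Scope ring_scope.
Local Open Scope quotient_scope.

(** * Bernoulli numbers

  A formal power series over [rat] is the sequence of its coefficients. *)

Definition fps_mul (a b : nat -> rat) : nat -> rat :=
  fun n => \sum_(k < n.+1) a k * b (n - k)%N.

(* The first [n] coefficients of the inverse of [a] (with [a 0 != 0]):
   c_m = ([m = 0] - \sum_(k < m) c_k a_(m - k)) / a_0. *)
Fixpoint fps_inv_upto (a : nat -> rat) (n : nat) : seq rat :=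
  if n is m.+1 then
    let c := fps_inv_upto a m in
    rcons c (((m == 0%N)%:R - \sum_(k < m) c`_k * a (m - k)%N) / a 0%N)
  else [::].

Definition fps_inv (a : nat -> rat) : nat -> rat :=
  fun n => (fps_inv_upto a n.+1)`_n.

(* t / (e^t - 1) is the inverse of (e^t - 1) / t = \sum_n t^n / (n + 1)!. *)
Definition bernoulli (n : nat) : rat :=
  n`!%:R * fps_inv (fun m => m.+1`!%:R^-1) n.

Lemma size_fps_inv_upto a n : size (fps_inv_upto a n) = n.
Proof. by elim: n => //= n IH; rewrite size_rcons IH. Qed.

Lemma nth_fps_inv_upto a n k : (k < n)%N -> (fps_inv_upto a n)`_k = fps_inv a k.
Proof.
elim: n => // n IH; rewrite ltnS leq_eqVlt => /orP[/eqP -> //|kn].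
by rewrite -IH //= nth_rcons size_fps_inv_upto kn.
Qed.

Lemma fps_mulV a : a 0%N != 0 ->
  fps_mul (fps_inv a) a = fun n => (n == 0%N)%:R.
Proof.
move=> a0; apply/funext => n; rewrite /fps_mul big_ord_recr /= subnn.
rewrite {2}/fps_inv /= nth_rcons size_fps_inv_upto ltnn eqxx.
rewrite (eq_bigr (fun k : 'I_n => (fps_inv_upto a n)`_k * a (n - k)%N)).
  by rewrite divfK // addrC subrK.
by move=> k _; rewrite nth_fps_inv_upto.
Qed.

(* (\sum_n B_n t^n / n!) (e^t - 1) = t *)
Lemma bernoulli_gf :
  fps_mul (fun n => bernoulli n / n`!%:R)
          (fun n => n`!%:R^-1 - (n == 0%N)%:R) = fun n => (n == 1%N)%:R.
Proof.
have fN0 n : n`!%:R != 0 :> rat by rewrite pnatr_eq0 -lt0n fact_gt0.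
pose c := fps_inv (fun m => m.+1`!%:R^-1).
have Ec n : bernoulli n / n`!%:R = c n by rewrite /bernoulli mulrC mulKf.
apply/funext => n; rewrite /fps_mul big_ord_recr /= subnn fact0 invr1 subrr.
rewrite mulr0 addr0; case: n => [|n]; first by rewrite big_ord0.
transitivity (fps_mul c (fun m => m.+1`!%:R^-1) n).
  apply: eq_bigr => k _; rewrite Ec subSn ?subr0 //=.
  by rewrite -ltnS.
by rewrite fps_mulV //= eqSS.
Qed.

Lemma bernoulli0 : bernoulli 0 = 1.
Proof. by rewrite /bernoulli /fps_inv /= big_ord0 subr0 !fact0. Qed.

Lemma bernoulli1 : bernoulli 1 = - 2%:R^-1.
Proof.
rewrite /bernoulli /fps_inv /= big_ord1 big_ord0 /=.
by rewrite factS fact0 !divr1 subr0 !mul1r sub0r.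
Qed.

(** * The p-adic absolute value on [rat] *)

Definition padic_val (p : nat) (x : rat) : int :=
  (logn p `|numq x|)%:Z - (logn p `|denq x|)%:Z.

(* When p is not prime, [logn p] is 0 and this is the trivial absolute value,
   so the construction of the completion below needs no primality. *)
Definition padic_abs (p : nat) (x : rat) : rat :=
  if x == 0 then 0 else p%:R ^ (- padic_val p x).

Section PadicAbs.
Variable p : nat.
Local Notation abs := (padic_abs p).
Implicit Types x y e : rat.

Lemma padic_val_notprime x : ~~ prime p -> padic_val p x = 0.
Proof.
move=> pN; have E n : logn p n = 0%N by rewrite lognE (negPf pN).
by rewrite /padic_val !E.
Qed.

Lemma padic_base_gt0 x : 0 < (p%:R : rat) ^ (- padic_val p x).
Proof.
have [pp|pN] := boolP (prime p); last by rewrite padic_val_notprime.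
by apply: exprz_gt0; rewrite ltr0n prime_gt0.
Qed.

Lemma padic_val_frac (n d : int) : n != 0 -> d != 0 ->
  padic_val p (n%:~R / d%:~R) = (logn p `|n|)%:Z - (logn p `|d|)%:Z.
Proof.
move=> n0 d0; set x : rat := _ / _.
have x0 : x != 0 by rewrite mulf_neq0 ?invr_eq0 ?intr_eq0.
have nx0 : numq x != 0 by rewrite numq_eq0.
have E : numq x * d = n * denq x.
  apply: (@intr_inj rat); rewrite !rmorphM /= numqE /x.
  by rewrite mulrAC divfK // intr_eq0.
have : logn p (`|numq x| * `|d|)%N = logn p (`|n| * `|denq x|)%N.
  by rewrite -!abszM E.
have dx0 := denq_neq0 x.
rewrite !lognM ?absz_gt0 // /padic_val => H; lia.
Qed.

Lemma padic_abs0 : abs 0 = 0. Proof. by rewrite /padic_abs eqxx. Qed.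

Lemma padic_abs_eq0 x : (abs x == 0) = (x == 0).
Proof.
rewrite /padic_abs; case: (eqVneq x 0) => [_|_]; first by rewrite eqxx.
by rewrite gt_eqF ?padic_base_gt0.
Qed.

Lemma padic_abs_ge0 x : 0 <= abs x.
Proof. by rewrite /padic_abs; case: eqP => // _; apply/ltW/padic_base_gt0. Qed.

Lemma padic_abs_gt0 x : (0 < abs x) = (x != 0).
Proof. by rewrite lt_neqAle padic_abs_ge0 andbT eq_sym padic_abs_eq0. Qed.

Lemma padic_absN x : abs (- x) = abs x.
Proof. by rewrite /padic_abs /padic_val oppr_eq0 numqN denqN abszN. Qed.

Lemma padic_absB x y : abs (x - y) = abs (y - x).
Proof. by rewrite -padic_absN opprB. Qed.

Lemma padic_absM x y : abs (x * y) = abs x * abs y.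
Proof.
have [->|x0] := eqVneq x 0; first by rewrite mul0r padic_abs0 mul0r.
have [->|y0] := eqVneq y 0; first by rewrite mulr0 padic_abs0 mulr0.
rewrite /padic_abs mulf_eq0 (negPf x0) (negPf y0) /=.
have -> : padic_val p (x * y) = padic_val p x + padic_val p y.
  rewrite -{1}(divq_num_den x) -{1}(divq_num_den y) mulf_div -!rmorphM /=.
  rewrite padic_val_frac ?mulf_neq0 ?numq_eq0 ?denq_neq0 //.
  rewrite !abszM !lognM ?absz_gt0 ?numq_eq0 ?denq_neq0 //.
  by rewrite /padic_val /numq /denq; lia.
have [pp|pN] := boolP (prime p); last by rewrite !padic_val_notprime.
by rewrite opprD expfzDr // pnatr_eq0 -lt0n prime_gt0.
Qed.

Lemma padic_abs1 : abs 1 = 1.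
Proof. by rewrite /padic_abs /padic_val /= !logn1 subrr. Qed.

Lemma padic_abs_prime : prime p -> abs p%:R = p%:R^-1.
Proof.
move=> pp; have p0 : (p != 0)%N by rewrite -lt0n prime_gt0.
rewrite /padic_abs pnatr_eq0 (negPf p0).
have := @padic_val_frac p 1 p0 isT; rewrite divr1 logn1 subr0 /= => ->.
by rewrite logn_prime // eqxx.
Qed.

Lemma padic_absV x : abs x^-1 = (abs x)^-1.
Proof.
have [->|x0] := eqVneq x 0; first by rewrite invr0 padic_abs0.
apply: (@mulfI _ (abs x)); first by rewrite padic_abs_eq0.
by rewrite -padic_absM !divff ?padic_abs_eq0 // padic_abs1.
Qed.

Lemma logn_absz_add (m n : int) : prime p -> m != 0 -> n != 0 -> m + n != 0 ->
  (logn p `|m| <= logn p `|n|)%N -> (logn p `|m| <= logn p `|(m + n)%R|)%N.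
Proof.
move=> pp m0 n0 s0 mn; set k := logn p `|m|.
rewrite -pfactor_dvdn ?absz_gt0 //.
have Hm : (Posz (p ^ k)%N %| m)%Z by rewrite dvdzE pfactor_dvdnn.
have Hn : (Posz (p ^ k)%N %| n)%Z by rewrite dvdzE pfactor_dvdn ?absz_gt0.
by have := rpredD Hm Hn; rewrite dvdzE.
Qed.

Lemma padic_absD x y : abs (x + y) <= Num.max (abs x) (abs y).
Proof.
have [->|x0] := eqVneq x 0; first by rewrite add0r le_max lexx orbT.
have [->|y0] := eqVneq y 0; first by rewrite addr0 le_max lexx.
have [->|xy0] := eqVneq (x + y) 0.
  by rewrite padic_abs0 le_max padic_abs_ge0.
rewrite /padic_abs (negPf x0) (negPf y0) (negPf xy0).
have [pp|pN] := boolP (prime p); last first.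
  by rewrite !padic_val_notprime // le_max lexx.
have p1 : 1 < (p%:R : rat) by rewrite ltr1n prime_gt1.
rewrite le_max !ler_eXz2l // !lerN2.
set d := denq x * denq y; set m := numq x * denq y; set n := numq y * denq x.
have dx0 := denq_neq0 x; have dy0 := denq_neq0 y.
have nx0 : numq x != 0 by rewrite numq_eq0.
have ny0 : numq y != 0 by rewrite numq_eq0.
have d0 : d != 0 by rewrite mulf_neq0.
have m0 : m != 0 by rewrite mulf_neq0.
have n0 : n != 0 by rewrite mulf_neq0.
have Ex : x = m%:~R / d%:~R.
  by rewrite !rmorphM /= -mulf_div divff ?intr_eq0 // mulr1 divq_num_den.
have Ey : y = n%:~R / d%:~R.
  rewrite /d (mulrC (denq x)) !rmorphM /= -mulf_div divff ?intr_eq0 // mulr1.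
  by rewrite divq_num_den.
have Es : x + y = (m + n)%:~R / d%:~R by rewrite {1}Ex {1}Ey -mulrDl rmorphD.
have s0 : m + n != 0.
  by apply: contraNneq xy0 => e; rewrite Es e mul0r.
rewrite Es padic_val_frac // {1}Ex {1}Ey !padic_val_frac //.
have [mn|/ltnW mn] := leqP (logn p `|m|) (logn p `|n|).
- by rewrite !lerD2r !lez_nat (logn_absz_add pp m0 n0 s0 mn).
- rewrite addrC in s0; rewrite (addrC m) !lerD2r !lez_nat.
  by rewrite (logn_absz_add pp n0 m0 s0 mn) orbT.
Qed.

Lemma padic_absD_lt x y e : abs x < e -> abs y < e -> abs (x + y) < e.
Proof.
by move=> xe ye; apply: le_lt_trans (padic_absD x y) _; rewrite gt_max xe.
Qed.

Lemma padic_abs_isosceles x y : abs (x - y) < abs y -> abs x = abs y.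
Proof.
move=> xy; apply/eqP; rewrite eq_le; apply/andP; split.
  have := padic_absD (x - y) y; rewrite subrK => /le_trans; apply.
  by rewrite ge_max lexx (ltW xy).
rewrite leNgt; apply/negP => xly.
have : abs (x + (y - x)) < abs y by rewrite padic_absD_lt // padic_absB.
by rewrite addrC subrK ltxx.
Qed.

End PadicAbs.

(** * The field of p-adic numbers

  [Qp p] is the completion of [rat] for the p-adic absolute value: the ring of
  Cauchy sequences modulo the ideal of null sequences. *)

Definition padic_cauchy (p : nat) : {pred nat -> rat} := fun u =>
  `[< forall e : rat, 0 < e -> exists N, forall m n, (N <= m)%N -> (N <= n)%N ->
      padic_abs p (u m - u n) < e >].

Definition padic_null (p : nat) (u : nat -> rat) : Prop :=
  forall e : rat, 0 < e -> exists N, forall n, (N <= n)%N ->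
    padic_abs p (u n) < e.

Section CauchyClosed.
Variable p : nat.
Local Notation abs := (padic_abs p).

Lemma padic_cauchyP (u : nat -> rat) : reflect
  (forall e : rat, 0 < e -> exists N, forall m n, (N <= m)%N -> (N <= n)%N ->
      abs (u m - u n) < e) (u \in padic_cauchy p).
Proof. exact: asboolP. Qed.

Lemma padic_cauchy_cst x : (fun=> x) \in padic_cauchy p.
Proof.
by apply/padic_cauchyP => e e0; exists 0%N => m n _ _; rewrite subrr padic_abs0.
Qed.

Lemma padic_cauchy_bounded (u : nat -> rat) : u \in padic_cauchy p ->
  exists2 M : rat, 0 < M & exists N, forall n, (N <= n)%N -> abs (u n) < M.
Proof.
move=> /padic_cauchyP /(_ 1 ltr01)[N HN].
exists (Num.max 1 (abs (u N)) + 1).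
  by rewrite ltr_wpDl ?ltr01 // le_max ler01.
exists N => n Nn; rewrite -(subrK (u N) (u n)).
apply: le_lt_trans (padic_absD _ _ _) _.
apply: (@le_lt_trans _ _ (Num.max 1 (abs (u N)))); last by rewrite ltrDl ltr01.
by rewrite ge_max !le_max lexx orbT andbT (ltW (HN _ _ _ _)).
Qed.

Lemma padic_null_mul (u v : nat -> rat) : u \in padic_cauchy p ->
  padic_null p v -> padic_null p (u * v).
Proof.
move=> /padic_cauchy_bounded[M M0 [N1 H1]] nv e e0.
have [N2 H2] := nv (e / M) (divr_gt0 e0 M0).
exists (maxn N1 N2) => n; rewrite geq_max => /andP[n1 n2].
have -> : (u * v) n = u n * v n by [].
rewrite padic_absM -(divfK (lt0r_neq0 M0) e) mulrC.
apply: ltr_pM; rewrite ?padic_abs_ge0 //; first exact: H2.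
exact: H1.
Qed.

Lemma padic_cauchy_subring : subring_closed (padic_cauchy p).
Proof.
split; first exact: padic_cauchy_cst.
- move=> u v /padic_cauchyP cu /padic_cauchyP cv; apply/padic_cauchyP => e e0.
  have [N1 H1] := cu e e0; have [N2 H2] := cv e e0.
  exists (maxn N1 N2) => m n; rewrite !geq_max => /andP[? ?] /andP[? ?].
  have -> : (u - v) m - (u - v) n = (u m - u n) - (v m - v n).
    by rewrite !addrfctE !opprfctE; ring.
  by rewrite padic_absD_lt ?padic_absN ?H1 ?H2.
- move=> u v cu cv; apply/padic_cauchyP => e e0.
  have [M M0 [N1 H1]] := padic_cauchy_bounded cu.
  have [L L0 [N2 H2]] := padic_cauchy_bounded cv.
  have [N3 H3] := (padic_cauchyP _ cu) (e / L) (divr_gt0 e0 L0).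
  have [N4 H4] := (padic_cauchyP _ cv) (e / M) (divr_gt0 e0 M0).
  exists (maxn (maxn N1 N2) (maxn N3 N4)) => m n; rewrite !geq_max.
  move=> /andP[/andP[? ?] /andP[? ?]] /andP[/andP[? ?] /andP[? ?]].
  have -> : (u * v) m - (u * v) n
          = (u m - u n) * v m + (v m - v n) * u n.
    by rewrite !mulrfctE; ring.
  apply: padic_absD_lt; rewrite padic_absM.
    rewrite -(divfK (lt0r_neq0 L0) e).
    by apply: ltr_pM; rewrite ?padic_abs_ge0 ?H2 ?H3.
  rewrite -(divfK (lt0r_neq0 M0) e).
  by apply: ltr_pM; rewrite ?padic_abs_ge0 ?H1 ?H4.
Qed.

HB.instance Definition _ := GRing.isSubringClosed.Build (nat -> rat)
  (padic_cauchy p) padic_cauchy_subring.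

(* A Cauchy sequence that is not null has eventually constant absolute value. *)
Lemma padic_cauchy_abs (u : nat -> rat) : u \in padic_cauchy p ->
  ~ padic_null p u ->
  exists2 r, 0 < r & exists N, forall n, (N <= n)%N -> abs (u n) = r.
Proof.
move=> /padic_cauchyP cu /existsNP[e /not_implyP[e0 /forallNP H]].
have [N HN] := cu e e0.
have /existsNP[n /not_implyP[Nn /negP]] := H N; rewrite -leNgt => en.
exists (abs (u n)); first exact: lt_le_trans en.
exists N => m Nm; apply: padic_abs_isosceles.
exact: lt_le_trans (HN _ _ Nm Nn) en.
Qed.

End CauchyClosed.

Definition padic_cauchy_seq (p : nat) := {u : nat -> rat | u \in padic_cauchy p}.

HB.instance Definition _ p := SubType.on (padic_cauchy_seq p).
HB.instance Definition _ p := Choice.on (padic_cauchy_seq p).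
HB.instance Definition _ p :=
  [SubChoice_isSubComNzRing of padic_cauchy_seq p by <:].

Definition padic_null_ideal (p : nat) : {pred padic_cauchy_seq p} :=
  fun u => `[< padic_null p (val u) >].
Arguments padic_null_ideal : clear implicits.

Section NullIdeal.
Variable p : nat.

Lemma padic_null_idealP (u : padic_cauchy_seq p) :
  reflect (padic_null p (val u)) (u \in padic_null_ideal p).
Proof. exact: asboolP. Qed.

Lemma padic_null_idealr : idealr_closed (padic_null_ideal p).
Proof.
split.
- apply/padic_null_idealP => e e0; exists 0%N => n _.
  by rewrite (_ : val _ n = 0) ?padic_abs0.
- apply/negP => /padic_null_idealP /(_ 1 ltr01)[N /(_ N (leqnn N))].
  by rewrite (_ : val _ N = 1) ?padic_abs1.
- move=> a u v /padic_null_idealP nu /padic_null_idealP nv.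
  apply/padic_null_idealP => e e0.
  have [N1 H1] := padic_null_mul (valP a) nu e0; have [N2 H2] := nv e e0.
  exists (maxn N1 N2) => n; rewrite geq_max => /andP[? ?].
  by apply: padic_absD_lt; [exact: H1|exact: H2].
Qed.

HB.instance Definition _ := isIdealr.Build (padic_cauchy_seq p)
  (padic_null_ideal p) padic_null_idealr.

End NullIdeal.

Definition Qp (p : nat) : Type := {ideal_quot (padic_null_ideal p)}.

HB.instance Definition _ p := GRing.ComNzRing.on (Qp p).
HB.instance Definition _ p := EqQuotient.on (Qp p).

Section QpTheory.
Variable p : nat.
Local Notation abs := (padic_abs p).
Implicit Types u v : padic_cauchy_seq p.

Definition Qp_class u : Qp p := \pi_(Qp p) u.

Lemma Qp_class_zmod_morphism : zmod_morphism Qp_class.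
Proof. by move=> u v; rewrite /Qp_class !piE. Qed.

Lemma Qp_class_monoid_morphism : monoid_morphism Qp_class.
Proof. by split=> [|u v]; rewrite /Qp_class !piE. Qed.

HB.instance Definition _ := GRing.isZmodMorphism.Build
  (padic_cauchy_seq p) (Qp p) Qp_class Qp_class_zmod_morphism.
HB.instance Definition _ := GRing.isMonoidMorphism.Build
  (padic_cauchy_seq p) (Qp p) Qp_class Qp_class_monoid_morphism.

Lemma Qp_classK x : Qp_class (repr x) = x.
Proof. exact: reprK. Qed.

Lemma Qp_class_eq u v : Qp_class u = Qp_class v <-> padic_null p (val u - val v).
Proof.
rewrite /Qp_class; split => [/eqP|H].
  by rewrite piE Quotient.equivE => /padic_null_idealP.
by apply/eqP; rewrite piE Quotient.equivE; apply/padic_null_idealP.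
Qed.

Lemma Qp_class_eq0 u : Qp_class u = 0 <-> padic_null p (val u).
Proof.
by rewrite -(rmorph0 Qp_class) Qp_class_eq (_ : val (0 : padic_cauchy_seq p) = 0)
  ?subr0.
Qed.

Definition Qp_inv (x : Qp p) : Qp p :=
  if x == 0 then 0 else Qp_class (insubd 0 (fun n => (val (repr x) n)^-1)).

Lemma Qp_inv_cauchy (u : nat -> rat) : u \in padic_cauchy p ->
  ~ padic_null p u -> (fun n => (u n)^-1) \in padic_cauchy p.
Proof.
move=> cu nu; have [r r0 [N1 H1]] := padic_cauchy_abs cu nu.
apply/padic_cauchyP => e e0.
have [N2 H2] := (padic_cauchyP _ _ cu) (e * (r * r)) (mulr_gt0 e0 (mulr_gt0 r0 r0)).
exists (maxn N1 N2) => m n; rewrite !geq_max => /andP[m1 m2] /andP[n1 n2].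
have um0 : u m != 0 by rewrite -(padic_abs_gt0 p) H1.
have un0 : u n != 0 by rewrite -(padic_abs_gt0 p) H1.
have -> : (u m)^-1 - (u n)^-1 = (u n - u m) / (u m * u n).
  by field; rewrite um0 un0.
rewrite padic_absM padic_absV padic_absM !H1 // ltr_pdivrMr ?mulr_gt0 //.
exact: H2.
Qed.

Lemma Qp_mulVf (x : Qp p) : x != 0 -> Qp_inv x * x = 1.
Proof.
move=> x0; rewrite /Qp_inv (negPf x0) -{2}[x]Qp_classK.
set u := repr x.
have nu : ~ padic_null p (val u).
  by move=> /Qp_class_eq0; rewrite Qp_classK => /eqP; rewrite (negPf x0).
have cu := Qp_inv_cauchy (valP u) nu.
rewrite -rmorphM -[RHS](rmorph1 Qp_class); apply/Qp_class_eq.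
have [r r0 [N H]] := padic_cauchy_abs (valP u) nu.
move=> e e0; exists N => n Nn.
have un0 : val u n != 0 by rewrite -(padic_abs_gt0 p) H.
rewrite (_ : _ n = (val u n)^-1 * val u n - 1).
  by rewrite mulVf // subrr padic_abs0.
have -> : forall v w, (val (v * w) - val (1 : padic_cauchy_seq p)) n
            = val v n * val w n - 1 by [].
by rewrite insubdK.
Qed.

Lemma Qp_inv0 : Qp_inv 0 = 0.
Proof. by rewrite /Qp_inv eqxx. Qed.

HB.instance Definition _ := GRing.ComNzRing_isField.Build (Qp p) Qp_mulVf Qp_inv0.

(* The absolute value of Qp extends padic_abs: it is the limit of the (rational)
   absolute values along any representative. *)
Definition Qp_abs (x : Qp p) : rat :=
  xget 0 [set r | forall e, 0 < e -> exists N, forall n, (N <= n)%N ->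
                    `|abs (val (repr x) n) - r| < e].

Lemma Qp_abs_class u r :
  (forall e, 0 < e -> exists N, forall n, (N <= n)%N -> `|abs (val u n) - r| < e) ->
  Qp_abs (Qp_class u) = r.
Proof.
move=> Hr; set v := repr (Qp_class u).
have Huv : padic_null p (val v - val u).
  by apply/Qp_class_eq; rewrite Qp_classK.
have Hv e : 0 < e ->
    exists N, forall n, (N <= n)%N -> `|abs (val v n) - r| < e.
  move=> e0; have e20 : 0 < e / 2 by rewrite divr_gt0.
  have [N1 H1] := Hr _ e20; have [N2 H2] := Huv _ e20.
  exists (maxn N1 N2) => n; rewrite geq_max => /andP[n1 n2].
  have := H1 n n1; have := H2 n n2.
  have -> : (val v - val u) n = val v n - val u n by [].
  move: (val v n) (val u n) => a b.
  have [ab|ab] := ltP (abs (a - b)) (abs b).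
    by rewrite (padic_abs_isosceles ab) => _ ?; lra.
  have := padic_absD p (a - b) b; rewrite subrK (max_idPl ab).
  have := padic_abs_ge0 p a; have := padic_abs_ge0 p b.
  rewrite !ltr_norml => ? ? ? ? /andP[? ?]; apply/andP; split; lra.
rewrite /Qp_abs; case: xgetP => [s _ /= Hs|/(_ r) /(_ Hv)] //.
apply/eqP; rewrite -subr_eq0 -normr_eq0 eq_le normr_ge0 andbT.
rewrite leNgt; apply/negP => rs.
have rs2 : 0 < `|s - r| / 2 by rewrite divr_gt0.
have [N1 H1] := Hs _ rs2; have [N2 H2] := Hv _ rs2.
have := H1 (maxn N1 N2) (leq_maxl _ _).
have := H2 (maxn N1 N2) (leq_maxr _ _); rewrite -/v.
move: (abs _) => t; rewrite (distrC t s) => A B.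
have := ler_normD (s - t) (t - r); rewrite subrKA => C; lra.
Qed.

Lemma Qp_abs_class_cst u r N :
  (forall n, (N <= n)%N -> abs (val u n) = r) -> Qp_abs (Qp_class u) = r.
Proof.
move=> H; apply: Qp_abs_class => e e0; exists N => n Nn.
by rewrite H // subrr normr0.
Qed.

Lemma Qp_abs0 : Qp_abs 0 = 0.
Proof.
rewrite -(rmorph0 Qp_class); apply: (@Qp_abs_class_cst _ _ 0%N) => n _.
exact: padic_abs0.
Qed.

Lemma Qp_absP x : x != 0 -> exists2 r, 0 < r & Qp_abs x = r /\
  exists N, forall n, (N <= n)%N -> abs (val (repr x) n) = r.
Proof.
move=> x0; have [|r r0 [N H]] := padic_cauchy_abs (valP (repr x)).
  by move=> /Qp_class_eq0; rewrite Qp_classK => /eqP; rewrite (negPf x0).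
exists r => //; split; last by exists N.
by rewrite -[x]Qp_classK (Qp_abs_class_cst H).
Qed.

Lemma Qp_abs_ge0 x : 0 <= Qp_abs x.
Proof.
have [->|/Qp_absP[r r0 [-> _]]] := eqVneq x 0; first by rewrite Qp_abs0.
exact: ltW.
Qed.

Lemma Qp_abs_eq0 x : Qp_abs x = 0 -> x = 0.
Proof.
have [->|/Qp_absP[r r0 [-> _]]] := eqVneq x 0 => // /eqP.
by rewrite gt_eqF.
Qed.

Lemma Qp_absM x y : Qp_abs (x * y) = Qp_abs x * Qp_abs y.
Proof.
have [->|x0] := eqVneq x 0; first by rewrite mul0r Qp_abs0 mul0r.
have [->|y0] := eqVneq y 0; first by rewrite mulr0 Qp_abs0 mulr0.
have [r r0 [-> [N1 H1]]] := Qp_absP x0; have [s s0 [-> [N2 H2]]] := Qp_absP y0.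
rewrite -[x]Qp_classK -[y]Qp_classK -rmorphM.
apply: (@Qp_abs_class_cst _ _ (maxn N1 N2)) => n.
rewrite geq_max => /andP[n1 n2].
have -> : forall v w, val (v * w) n = val v n * val w n by [].
by rewrite padic_absM H1 ?H2.
Qed.

Lemma Qp_absN x : Qp_abs (- x) = Qp_abs x.
Proof.
have [->|x0] := eqVneq x 0; first by rewrite oppr0.
have [r r0 [-> [N H]]] := Qp_absP x0; rewrite -[x]Qp_classK -rmorphN.
apply: (@Qp_abs_class_cst _ _ N) => n Nn.
by rewrite -(H n Nn) -[RHS]padic_absN.
Qed.

Lemma Qp_absD x y : Qp_abs (x + y) <= Num.max (Qp_abs x) (Qp_abs y).
Proof.
have [->|x0] := eqVneq x 0; first by rewrite add0r le_max lexx orbT.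
have [->|y0] := eqVneq y 0; first by rewrite addr0 le_max lexx.
have [xy|xy0] := eqVneq (x + y) 0; first by rewrite xy Qp_abs0 le_max Qp_abs_ge0.
have [r r0 [-> [N1 H1]]] := Qp_absP x0; have [s s0 [-> [N2 H2]]] := Qp_absP y0.
have nu : ~ padic_null p (val (repr x + repr y)).
  move=> /Qp_class_eq0; rewrite rmorphD /= !Qp_classK => /eqP.
  by rewrite (negPf xy0).
have [t t0 [N3 H3]] := padic_cauchy_abs (valP (repr x + repr y)) nu.
rewrite -[x]Qp_classK -[y]Qp_classK -rmorphD (Qp_abs_class_cst H3).
set N := maxn N3 (maxn N1 N2).
have N3N : (N3 <= N)%N by rewrite leq_maxl.
have N1N : (N1 <= N)%N by rewrite /N maxnCA leq_maxl.
have N2N : (N2 <= N)%N by rewrite /N maxnA leq_maxr.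
by rewrite -(H3 _ N3N) -(H1 _ N1N) -(H2 _ N2N); exact: padic_absD.
Qed.

HB.instance Definition _ := isPointed.Build (Qp p) 0.

Let Qp_distxx x : Qp_abs (x - x) = 0.
Proof. by rewrite subrr Qp_abs0. Qed.

Let Qp_dist_eq0 x y : Qp_abs (x - y) = 0 -> x = y.
Proof. by move=> /Qp_abs_eq0 /eqP; rewrite subr_eq0 => /eqP. Qed.

Let Qp_dist_sym x y : Qp_abs (x - y) = Qp_abs (y - x).
Proof. by rewrite -Qp_absN opprB. Qed.

Let Qp_dist_triangle y x z :
  Qp_abs (x - z) <= Qp_abs (x - y) + Qp_abs (y - z).
Proof.
rewrite -(subrKA y x (- z)); apply: le_trans (Qp_absD _ _) _.
by rewrite ge_max lerDl lerDr !Qp_abs_ge0.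
Qed.

HB.instance Definition _ := isMetric.Build rat (Qp p)
  Qp_distxx Qp_dist_eq0 Qp_dist_sym Qp_dist_triangle.

Definition padic_cst (q : rat) : padic_cauchy_seq p :=
  exist _ (fun=> q) (padic_cauchy_cst p q).

Lemma Qp_ratrE (q : rat) : ratr q = Qp_class (padic_cst q).
Proof.
pose c x := Qp_class (padic_cst x).
have cM : {morph c : x y / x * y}.
  by move=> x y; rewrite /c -rmorphM; congr Qp_class; apply: val_inj.
have cB : {morph c : x y / x - y}.
  by move=> x y; rewrite /c -rmorphB; congr Qp_class; apply: val_inj.
have c1 : c 1 = 1.
  by rewrite -(rmorph1 Qp_class); congr Qp_class; apply: val_inj.
have cadd : zmod_morphism c by move=> x y; rewrite cB.
have cmul : monoid_morphism c by split.
pose cA := GRing.isZmodMorphism.Build _ _ c cadd.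
pose cMu := GRing.isMonoidMorphism.Build _ _ c cmul.
pose C : {rmorphism rat -> Qp p} := HB.pack c cA cMu.
rewrite -[RHS]/(C q) -{2}(divq_num_den q) fmorph_div !rmorph_int.
by [].
Qed.

Lemma Qp_abs_ratr (q : rat) : Qp_abs (ratr q) = abs q.
Proof. by rewrite Qp_ratrE; apply: (@Qp_abs_class_cst _ _ 0%N). Qed.

(* Every p-adic number is the limit of each Cauchy sequence representing it. *)
Lemma Qp_cvg_class u : (fun n => ratr (val u n) : Qp p) @ \oo --> Qp_class u.
Proof.
apply/cvg_ballP => e e0.
have [N H] := (padic_cauchyP _ _ (valP u)) e e0.
exists N => // n Nn /=; rewrite ballEmdist /=.
pose w := u - padic_cst (val u n).
suff : Qp_abs (Qp_class w) < e by rewrite Qp_class_zmod_morphism -Qp_ratrE.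
have [/Qp_class_eq0 ->|nw] := pselect (padic_null p (val w)).
  by rewrite Qp_abs0.
have [r r0 [M HM]] := padic_cauchy_abs (valP w) nw.
rewrite (Qp_abs_class_cst HM) -(HM (maxn N M)) ?leq_maxr //.
rewrite -[val w _]/(val u (maxn N M) - val u n).
by apply: H; rewrite ?leq_maxl.
Qed.

End QpTheory.

(** * The number R_p(a/F) *)

Definition Rp_term (a : int) (F n : nat) : rat :=
  bernoulli n * (- (F%:R / a%:~R)) ^+ n.+1.

(* [limn] is 0 when the series diverges. *)
Definition Rp (p : nat) (a : int) (F : nat) : Qp p :=
  limn (series (fun n => ratr (Rp_term a F n) : Qp p)).

(* Main.v *)
From HB Require Import structures.
Require Import Defs.
From mathcomp Require Import all_boot all_order all_algebra.
From mathcomp Require Import all_classical all_reals all_analysis.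
From mathcomp Require Import ring lra zify.

(** Let [bern] be the linear functional on polynomials that sends t^n to the
  Bernoulli number B_n. With y = - a / F, the number R_p(a/F) is the value of
  [bern] on the expansion in powers of t / y of 1 / (t - y), up to sign, so
  that its rational approximations are governed by the polynomials orthogonal
  for [bern]. These are
    Q_n(t) = \sum_k C(n, k) C(n + k, k) C(t, k),
  because [bern] maps C(t, k) to (-1)^k / (k + 1), the integral of (-u)^k over
  [0, 1], and thereby Q_n to a shifted Legendre polynomial.
  Put q_n = Q_n(y) and let p_n be the image under [bern] of the divided
  difference (Q_n(t) - Q_n(y)) / (t - y).

  Four facts bear on the rational numbers q_n and p_n.
  - Orthogonality kills the first n terms of q_n R_p(a/F) - p_n, and the others
    are divisible by n! up to a linear factor; hence the p-adic absolute value
    is at most (2n + 1) |n!|_p p^(-r(n+1)) ([pade_remainder_bound]).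
  - Both sequences satisfy the same three-term recurrence ([pade_q_rec],
    [pade_p_rec]), whose limit u_(n+2) = u_n has characteristic roots 1 and -1:
    they grow at most polynomially ([pade_recurrence_growth]).
  - The Casoratian of the recurrence never vanishes, so that two consecutive
    forms q_n alpha - p_n cannot both be zero ([pade_forms_neq0]).
  - F^n \prod_(q | F) q^(n / (q - 1)) lcm(1, ..., n)^2 is a common denominator
    ([pade_q_int], [pade_p_int]).

  If R_p(a/F) is a rational alpha, the nonzero forms q_n alpha - p_n cleared
  of denominators are nonzero integers, whose ordinary absolute value is at
  least the inverse of the p-adic one. This gives [Rp_rational_ineq], whose
  logarithm divided by n contradicts the hypothesis as soon as
  log lcm(1, ..., n) <= (1 + e) n. It is enough that this holds for infinitely
  many n, which follows from Chebyshev's argument on the factorization of n!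
  ([ln_lcm_upto_frequently]). *)

Set Implicit Arguments.
Unset Strict Implicit.
Unset Printing Implicit Defensive.

Import Order.TTheory GRing.Theory Num.Theory.

Local Open Scope classical_set_scope.
Local Open Scope ring_scope.

(** * Factorials, least common multiples and arithmetic progressions *)

Local Open Scope nat_scope.

Lemma logn_prod (I : eqType) (s : seq I) (P : pred I) (f : I -> nat) p :
  {in s, forall i, 0 < f i} ->
  logn p (\prod_(i <- s | P i) f i) = \sum_(i <- s | P i) logn p (f i).
Proof.
move=> f0; elim: s f0 => [|i s IH] f0; first by rewrite !big_nil logn1.
rewrite !big_cons; have f0s : {in s, forall i, 0 < f i}.
  by move=> j js; apply: f0; rewrite inE js orbT.
case: (P i); last exact: IH.
rewrite lognM ?IH ?f0 ?mem_head //.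
by rewrite big_seq_cond; apply: prodn_cond_gt0 => j /andP[/f0s].
Qed.

(** lcm(1, ..., n), through its factorization, so that its valuations can be
  read off. The primes up to n are those that divide n!. *)
Definition lcm_upto n := \prod_(q <- primes n`!) q ^ trunc_log q n.

Lemma prime_dvd_fact q n : prime q -> (q %| n`!) = (q <= n).
Proof.
move=> qp; elim: n => [|n IH]; first by rewrite fact0 dvdn1; case: q qp => [|[]].
rewrite factS Euclid_dvdM // IH; case: (leqP q n) => [/leqW ->|nq]; first by rewrite orbT.
rewrite orbF; apply/idP/idP => [/dvdn_leq->//|]; move=> h.
by rewrite (_ : q = n.+1) //; apply/eqP; rewrite eqn_leq h.
Qed.

Lemma logn_prod_primes q (s : nat) (e : nat -> nat) :
  logn q (\prod_(x <- primes s) x ^ e x) = (q \in primes s) * e q.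
Proof.
rewrite logn_prod; last first.
  by move=> i; rewrite mem_primes => /andP[/prime_gt0 i0 _]; rewrite expn_gt0 i0.
have [qs|qs] := boolP (q \in primes s).
  rewrite (bigD1_seq q) ?primes_uniq //= lognX logn_prime ?eqxx ?muln1 ?mul1n.
    rewrite big1_seq ?addn0 // => i /andP[iq].
    by rewrite mem_primes => /andP[ip _]; rewrite lognX logn_prime // eq_sym (negPf iq) muln0.
  by move: qs; rewrite mem_primes => /andP[].
rewrite mul0n big1_seq // => i /andP[_ si]; rewrite lognX logn_prime.
  by case: eqP qs => [->|]; rewrite ?si ?muln0.
by move: si; rewrite mem_primes => /andP[].
Qed.

Lemma logn_lcm_upto q n : prime q -> logn q (lcm_upto n) = trunc_log q n.
Proof.
move=> qp; rewrite logn_prod_primes mem_primes qp fact_gt0 /= prime_dvd_fact //.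
case: leqP => [_|nq]; rewrite ?mul1n // mul0n; apply/esym/eqP.
by rewrite trunc_log_eq0; apply/orP; right; lia.
Qed.

Lemma lcm_upto_gt0 n : 0 < lcm_upto n.
Proof.
rewrite /lcm_upto big_seq_cond; apply: prodn_cond_gt0 => q.
by rewrite mem_primes => /andP[/andP[/prime_gt0 q0 _] _]; rewrite expn_gt0 q0.
Qed.

Lemma dvdn_logn m n : 0 < m -> 0 < n ->
  (forall q, prime q -> logn q m <= logn q n) -> m %| n.
Proof.
move=> m0 n0 H; apply/dvdn_partP => // q; rewrite mem_primes => /and3P[qp _ _].
by rewrite p_part pfactor_dvdn // H.
Qed.

Lemma dvdn_lcm_upto i n : 0 < i <= n -> i %| lcm_upto n.
Proof.
move=> /andP[i0 le_in]; apply: dvdn_logn => // [|q qp]; first exact: lcm_upto_gt0.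
rewrite logn_lcm_upto //; apply: trunc_log_max; first exact: prime_gt1.
by apply: leq_trans le_in; rewrite dvdn_leq // pfactor_dvdnn.
Qed.

Lemma lcm_uptoS n : lcm_upto n.+1 %| n.+1 * lcm_upto n.
Proof.
have d0 := lcm_upto_gt0; apply: dvdn_logn => // [|q qp]; first by rewrite muln_gt0 d0.
rewrite lognM // !logn_lcm_upto //.
set t := trunc_log q n.+1; case: (leqP t (trunc_log q n)) => [h|h]; first lia.
have q1 := prime_gt1 qp.
have tn : q ^ t = n.+1.
  apply/eqP; rewrite eqn_leq trunc_logP //= ltnNge; apply/negP => /(trunc_log_max _)-/(_ q1).
  by rewrite leqNgt h.
have : logn q n.+1 = t by rewrite -tn pfactorK.
lia.
Qed.

Lemma sum_leq_count t n : t <= n -> \sum_(1 <= j < n.+1) (j <= t : nat) = t.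
Proof.
move=> tn; suff -> : \sum_(1 <= j < n.+1) (j <= t : nat) = minn t n by lia.
elim: n {tn} => [|n IH]; first by rewrite big_geq // minn0.
by rewrite big_nat_recr //= IH; case: (leqP n.+1 t) => ?; lia.
Qed.

(** The q-adic valuation of either side counts the pairs (j, k) of positive
  integers with k q^j <= n: summing over k first gives Legendre's formula,
  summing over j first gives the valuation of lcm(1, ..., n / k). *)
Lemma fact_lcm_upto n : n`! = \prod_(1 <= k < n.+1) lcm_upto (n %/ k).
Proof.
have d0 := lcm_upto_gt0.
apply: eqn_from_log => [|| q]; first exact: fact_gt0.
  by apply: prodn_gt0.
have [qp|qN] := boolP (prime q); last first.
  by have E m : logn q m = 0 by [rewrite lognE (negPf qN)]; rewrite !E.
have q1 := prime_gt1 qp.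
rewrite logn_prod // logn_fact //.
under [RHS]eq_bigr => k _ do rewrite logn_lcm_upto //.
transitivity (\sum_(1 <= j < n.+1) \sum_(1 <= k < n.+1) (k * q ^ j <= n : nat)).
  apply: eq_bigr => j _; rewrite -{1}(@sum_leq_count (n %/ q ^ j) n) ?leq_div //.
  by apply: eq_bigr => k _; rewrite leq_divRL ?expn_gt0 ?prime_gt0.
rewrite exchange_big /= !big_nat; apply: eq_bigr => k /andP[k0 kn].
have nk0 : 0 < n %/ k by rewrite divn_gt0.
rewrite -[RHS](@sum_leq_count _ n).
  apply: eq_bigr => j _; congr nat_of_bool; rewrite mulnC -leq_divRL //.
  apply/idP/idP => [|h]; first exact: trunc_log_max.
  by apply: leq_trans (trunc_logP q1 nk0); rewrite leq_exp2l.
apply: leq_trans (leq_div n k); apply: leq_trans (trunc_logP q1 nk0).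
by apply: ltnW; apply: ltn_expl.
Qed.

(** Legendre's formula telescopes, as (q - 1) (n / q^k) is at most
  n / q^(k-1) - n / q^k. *)
Lemma logn_fact_ub q n : prime q -> q.-1 * logn q n`! <= n.
Proof.
move=> qp; rewrite logn_fact //; have q0 := prime_gt0 qp.
suff H K : q.-1 * (\sum_(1 <= k < K.+1) n %/ q ^ k) + n %/ q ^ K <= n.
  by apply: leq_trans (H n); apply: leq_addr.
elim: K => [|K IH]; first by rewrite big_geq // expn0 divn1 muln0.
apply: leq_trans IH; rewrite big_nat_recr //= expnSr divnMA.
rewrite mulnDr -addnA leq_add2l addnC -mulSn prednK // mulnC.
exact: leq_trunc_div.
Qed.

(** The telescoping of [logn_fact_ub] loses at most q - 1 at each step, and the
  terms n / q^k with k > [trunc_log q n] vanish. *)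
Lemma logn_fact_lb q n : prime q ->
  n <= q.-1 * (logn q n`! + (trunc_log q n).+1).
Proof.
move=> qp; rewrite logn_fact //; have q0 := prime_gt0 qp; have q1 := prime_gt1 qp.
have H K : n <= q.-1 * (\sum_(1 <= k < K.+1) n %/ q ^ k + K) + n %/ q ^ K.
  elim: K => [|K IH]; first by rewrite big_geq // expn0 divn1 leq_addl.
  rewrite big_nat_recr //= expnSr divnMA; apply: leq_trans IH _.
  move: (\sum_(_ <= k < _) _) => S; set t := n %/ q ^ K.
  have := divn_eq t q; have := ltn_pmod t q0.
  have -> : (t %/ q) * q = q.-1 * (t %/ q) + t %/ q.
    by rewrite addnC -mulSn prednK // mulnC.
  rewrite !mulnDr mulnS; lia.
case: (posnP n) => [->//|n0].
have := H (trunc_log q n).+1; rewrite (divn_small (trunc_log_ltn n q1)) addn0.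
move=> /leq_trans; apply; rewrite leq_mul2l leq_add2r; apply/orP; right.
have tn : (trunc_log q n).+1 <= n.
  by apply: leq_trans (trunc_logP q1 n0); apply: ltn_expl.
by rewrite [leqRHS](big_cat_nat _ (n := (trunc_log q n).+2)) //= leq_addr.
Qed.

(** The contribution of the primes dividing F, beyond F^k, to the denominator
  of the binomial coefficient of c / F and k; see [binr_int]. *)
Definition binom_den (F k : nat) := \prod_(q <- primes F) q ^ (k %/ q.-1).

Lemma binom_den_gt0 F k : 0 < binom_den F k.
Proof.
rewrite /binom_den big_seq_cond; apply: prodn_cond_gt0 => q.
by rewrite mem_primes => /andP[/andP[/prime_gt0 q0 _] _]; rewrite expn_gt0 q0.
Qed.

Lemma binom_denD F i j : binom_den F i * binom_den F j %| binom_den F (i + j).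
Proof.
apply: dvdn_logn => [||q qp]; rewrite ?muln_gt0 ?binom_den_gt0 //.
rewrite lognM ?binom_den_gt0 // !logn_prod_primes -mulnDr leq_mul2l.
rewrite leq_divRL; last by have := prime_gt1 qp; lia.
by rewrite mulnDl leq_add ?leq_trunc_div ?orbT.
Qed.

Lemma binom_den_leq F i j : i <= j -> binom_den F i %| binom_den F j.
Proof.
move=> /subnKC <-; exact: dvdn_trans (dvdn_mulr _ (dvdnn _)) (binom_denD _ _ _).
Qed.

Lemma eqz_mod_prod (I : Type) (s : seq I) (f g : I -> int) (d : int) :
  (forall i, (f i = g i %[mod d])%Z) ->
  (\prod_(i <- s) f i = \prod_(i <- s) g i %[mod d])%Z%R.
Proof.
move=> fg; elim: s => [|i s IH]; first by rewrite !big_nil.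
by rewrite !big_cons -modzMml fg modzMml -modzMmr IH modzMmr.
Qed.

Lemma prod_ffact_int m k : (\prod_(j < k) (m%:Z - j%:Z) = (m ^_ k)%:Z)%R.
Proof.
elim: k => [|k IH]; first by rewrite big_ord0.
rewrite big_ord_recr /= IH ffactnSr PoszM.
case: (leqP k m) => km; first by rewrite subzn.
by rewrite ffact_small // !mul0r.
Qed.

(** The part of k! supported on the primes of F divides [binom_den F k] by
  Legendre's formula. The remaining part B is prime to F, hence c is congruent
  to F m modulo B for some m, and the product becomes F^k times a product of k
  consecutive integers. *)
Lemma dvdz_prod_arith (F k : nat) (c : int) : 0 < F ->
  (k`!%:Z %| (binom_den F k)%:Z * \prod_(j < k) (c - j%:Z * F%:Z))%Z%R.
Proof.
move=> F0; pose A := k`!`_(\pi(F)); pose B := k`!`_(\pi(F)^').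
have AB : k`! = A * B by rewrite partnC ?fact_gt0.
have B0 : 0 < B by rewrite part_gt0.
rewrite AB PoszM; apply: dvdz_mul.
  rewrite dvdzE /=; apply: dvdn_logn => [||q qp]; rewrite ?part_gt0 ?binom_den_gt0 //.
  rewrite logn_prod_primes; case: (boolP (q \in primes F)) => qF.
    rewrite mul1n leq_divRL; last by have := prime_gt1 qp; lia.
    apply: leq_trans _ (logn_fact_ub k qp); rewrite mulnC leq_mul2l.
    by rewrite dvdn_leq_log ?orbT ?fact_gt0 ?dvdn_part.
  rewrite mul0n leqn0 -leqn0 leqNgt logn_gt0 primes_part mem_filter.
  by rewrite inE /= (negPf qF).
have cop : coprimez F%:Z B%:Z.
  by rewrite coprimezE /= (@pnat_coprime \pi(F)) ?part_pnat // pnat_pi.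
have [[u v] /= uv] := coprimezP _ _ cop.
(* a representative of c / F modulo B *)
pose m := `|((c * u)%R %% B)%Z|%N.
have Em : (m%:Z = ((c * u)%R %% B)%Z)%R.
  by rewrite /m gez0_abs // modz_ge0 //; lia.
have H (j : nat) : (c - j%:Z * F%:Z = F%:Z * (m%:Z - j%:Z) %[mod B])%Z%R.
  apply/eqP; rewrite eqz_mod_dvd; apply/dvdzP.
  exists (c * v + F%:Z * ((c * u)%R %/ B)%Z)%R.
  have := divz_eq (c * u)%R B; rewrite -Em => E.
  have -> : (c - j%:Z * F%:Z - F%:Z * (m%:Z - j%:Z) = c - F%:Z * m%:Z)%R by ring.
  have -> : (m%:Z = c * u - (((c * u)%R %/ B)%Z * B%:Z))%R by rewrite {1}E; ring.
  by rewrite -{1}[c]mulr1 -uv; ring.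
rewrite -[X in (_ %| X)%Z]subr0 -eqz_mod_dvd.
apply/eqP; rewrite (eqz_mod_prod _ (fun j : 'I_k => H j)) big_split /= prodr_const card_ord.
rewrite prod_ffact_int.
apply/eqP; rewrite eqz_mod_dvd subr0 dvdz_mull // dvdzE /= -bin_ffact AB.
by rewrite dvdn_mull // dvdn_mull.
Qed.

Local Open Scope ring_scope.

(** * The Bernoulli functional *)

Definition bern (f : {poly rat}) : rat := \sum_(i < size f) f`_i * bernoulli i.

Lemma bern_wide n (f : {poly rat}) : (size f <= n)%N ->
  bern f = \sum_(i < n) f`_i * bernoulli i.
Proof.
move=> fn; rewrite /bern (big_ord_widen n (fun i => f`_i * bernoulli i) fn).
rewrite big_mkcond; apply: eq_bigr => i _; case: ltnP => // le.
by rewrite nth_default ?mul0r.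
Qed.

Lemma bern_is_scalar : scalar bern.
Proof.
move=> c f g; pose n := maxn (size f) (size g).
have fn : (size f <= n)%N by rewrite leq_maxl.
have gn : (size g <= n)%N by rewrite leq_maxr.
have sn : (size (c *: f + g)%R <= n)%N.
  rewrite (leq_trans (size_polyD _ _)) // geq_max gn andbT.
  exact: leq_trans (size_scale_leq _ _) fn.
rewrite (bern_wide fn) (bern_wide gn) (bern_wide sn) mulr_sumr -big_split /=.
by apply: eq_bigr => i _; rewrite coefD coefZ mulrDl mulrA.
Qed.

HB.instance Definition _ := GRing.isLinear.Build rat {poly rat} rat *%R bern
  bern_is_scalar.

Lemma bernZ c f : bern (c *: f) = c * bern f.
Proof. exact: linearZ. Qed.

Lemma bernXn n : bern 'X^n = bernoulli n.
Proof.
rewrite (@bern_wide n.+1) ?size_polyXn // big_ord_recr /= coefXn eqxx mul1r.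
by rewrite big1 ?add0r // => i _; rewrite coefXn ltn_eqF ?mul0r.
Qed.

Lemma bern_shiftX n : bern (('X + 1) ^+ n - 'X^n) = (n == 1%N)%:R.
Proof.
rewrite exprD1n big_ord_recr /= binn addrK raddf_sum /=.
have fN0 k : k`!%:R != 0 :> rat by rewrite pnatr_eq0 -lt0n fact_gt0.
have -> : (n == 1%N)%:R = n`!%:R * (n == 1%N)%:R :> rat.
  by case: eqP => [->|_]; rewrite ?mulr0 ?fact0 ?mulr1.
rewrite -(congr1 (fun f => f n) bernoulli_gf) /fps_mul big_ord_recr /= subnn.
rewrite fact0 invr1 subrr mulr0 addr0 mulr_sumr; apply: eq_bigr => i _.
have ni := ltn_ord i; rewrite subn_eq0 leqNgt ni subr0.
rewrite raddfMn /= bernXn -mulr_natr -(bin_fact (ltnW ni)) !natrM.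
by field; rewrite !fN0.
Qed.

(** By linearity, the case f = t^n suffices; it is the recurrence of the
  Bernoulli numbers contained in their generating function. *)
Lemma bern_shift f : bern (f \Po ('X + 1) - f) = f`_1.
Proof.
rewrite -[in LHS](coefK f) poly_def.
transitivity (\sum_(i < size f) f`_i * (i == 1%N :> nat)%:R).
  rewrite raddf_sum /= -sumrB raddf_sum /=; apply: eq_bigr => i _.
  by rewrite linearZ /= comp_Xn_poly -scalerBr bernZ bern_shiftX.
have [s1|s1] := ltnP 1 (size f).
  rewrite (bigD1 (Ordinal s1)) //= mulr1 big1 ?addr0 // => i i1.
  by rewrite -[i == 1%N :> nat]/(i == Ordinal s1) (negPf i1) mulr0.
rewrite nth_default // big1 // => i _.
by rewrite (_ : (i == 1%N :> nat) = false) ?mulr0 //; have := ltn_ord i; lia.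
Qed.

Definition ffallr (A : pzRingType) (x : A) k : A := \prod_(i < k) (x - i%:R).

Definition frise m : {poly rat} := \prod_(i < m) ('X + i.+1%:R).

Lemma ffallrS (A : pzRingType) (x : A) k : ffallr x k.+1 = ffallr x k * (x - k%:R).
Proof. by rewrite /ffallr big_ord_recr. Qed.

Lemma ffallrS1 (A : comPzRingType) (x : A) k : ffallr x k.+1 = x * ffallr (x - 1) k.
Proof.
rewrite /ffallr big_ord_recl subr0; congr (_ * _); apply: eq_bigr => i _.
by rewrite lift0 -natr1; ring.
Qed.

Lemma ffallr0 (A : pzRingType) (x : A) : ffallr x 0 = 1.
Proof. by rewrite /ffallr big_ord0. Qed.

Lemma friseS m : frise m.+1 = frise m * ('X + m.+1%:R).
Proof. by rewrite /frise big_ord_recr. Qed.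

Lemma natr_poly (n : nat) : n%:R = n%:R%:P :> {poly rat}.
Proof. by rewrite rmorph_nat. Qed.

Lemma ffallr_comp (f : {poly rat}) k : ffallr 'X k \Po f = ffallr f k.
Proof.
rewrite /ffallr rmorph_prod; apply: eq_bigr => i _ /=.
by rewrite rmorphB /= comp_polyX natr_poly comp_polyC.
Qed.

Lemma frise_comp m : ('X + 1) * (frise m \Po ('X + 1)) = frise m.+1.
Proof.
rewrite /frise rmorph_prod big_ord_recl; congr (_ * _).
apply: eq_bigr => i _; rewrite lift0 /= rmorphD /= comp_polyX natr_poly comp_polyC.
by rewrite -natr_poly -[i.+2%:R]natr1; ring.
Qed.

Lemma horner0_ffall k : (ffallr ('X - 1 : {poly rat}) k).[0] = (-1) ^+ k * k`!%:R.
Proof.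
elim: k => [|k IH]; first by rewrite ffallr0 hornerC mul1r.
rewrite ffallrS hornerM IH natr_poly !hornerE factS natrM exprS -natr1.
ring.
Qed.

Lemma horner0_frise m : (frise m).[0] = m`!%:R.
Proof.
elim: m => [|m IH]; first by rewrite /frise big_ord0 hornerC.
by rewrite friseS hornerM IH natr_poly !hornerE factS natrM mulrC.
Qed.

(** An antidifference is explicit: h = t (t - 1) ... (t - k) (t + 1) ... (t + m)
  satisfies h(t + 1) - h(t) = (k + m + 1) [ffallr t k * frise m], and
  [bern_shift] evaluates its image as the linear coefficient of h. *)
Lemma bern_fall_rise k m :
  bern (ffallr 'X k * frise m) = (-1) ^+ k * k`!%:R * m`!%:R / (k + m).+1%:R.
Proof.
have n0 : (k + m).+1%:R != 0 :> rat by rewrite pnatr_eq0.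
apply: (mulIf n0); rewrite divfK //.
pose h := ffallr 'X k.+1 * frise m.
have <- : h`_1 = (-1) ^+ k * k`!%:R * m`!%:R.
  rewrite /h ffallrS1 -(mulrA 'X) coefXM /= -horner_coef0 hornerM.
  by rewrite horner0_ffall horner0_frise.
rewrite -bern_shift /h.
rewrite rmorphM /= ffallr_comp ffallrS1 addrK mulrAC frise_comp friseS ffallrS.
have -> : frise m * ('X + m.+1%:R) * ffallr 'X k - ffallr 'X k * ('X - k%:R) * frise m
   = (k + m).+1%:R *: (ffallr 'X k * frise m).
  rewrite -mul_polyC -natr_poly -addnS natrD; ring.
by rewrite bernZ mulrC.
Qed.

(** * Orthogonal polynomials for the Bernoulli functional *)

Lemma fact_neq0 n : n`!%:R != 0 :> rat.
Proof. by rewrite pnatr_eq0 -lt0n fact_gt0. Qed.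

Lemma natr_ffactSr m k :
  (m ^_ k.+1)%:R = (m ^_ k)%:R * (m%:R - k%:R) :> rat.
Proof.
rewrite ffactnSr natrM; case: (leqP k m) => km; first by rewrite natrB.
by rewrite ffact_small // !mul0r.
Qed.

Lemma ffactnD m j k : (m ^_ (j + k) = m ^_ j * (m - j) ^_ k)%N.
Proof.
elim: k => [|k IH]; first by rewrite addn0 ffactn0 muln1.
by rewrite addnS !ffactnSr IH -mulnA subnDA.
Qed.

Definition pade_coef n k : rat := ('C(n, k) * 'C(n + k, k))%:R / k`!%:R.

(** A single falling factorial turns shifts of n and k into the
  multiplication or removal of end factors; the recurrence in n thereby becomes
  a polynomial identity. *)
Lemma pade_coefE n k : pade_coef n k = ((n + k) ^_ k.*2)%:R / k`!%:R ^+ 3.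
Proof.
rewrite -addnn ffactnD addnK -!bin_ffact !natrM /pade_coef natrM.
by field; rewrite fact_neq0.
Qed.

Lemma pade_coef_gt n k : (n < k)%N -> pade_coef n k = 0.
Proof. by move=> nk; rewrite /pade_coef bin_small // mul0n mul0r. Qed.

Lemma pade_coef0 n : pade_coef n 0 = 1.
Proof. by rewrite /pade_coef !bin0 fact0 divr1. Qed.

Lemma pade_coef_rec n j :
  n.+2%:R ^+ 2 * pade_coef n.+2 j.+1 =
  (n.+1.*2.+1)%:R * ((j.+1.*2.+1)%:R * pade_coef n.+1 j.+1 + 2 * pade_coef n.+1 j)
  + n.+1%:R ^+ 2 * pade_coef n j.+1.
Proof.
rewrite !pade_coefE !doubleS.
(* the common factor of the three falling factorials of the recurrence *)
pose W : rat := ((n.+1 + j) ^_ j.*2)%:R.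
have -> : ((n.+2 + j.+1) ^_ j.*2.+2)%:R = (n + j + 3)%:R * (n + j + 2)%:R * W.
  by rewrite (_ : n.+2 + j.+1 = (n.+1 + j).+2)%N ?ffactSS ?natrM ?mulrA; last lia;
     congr (_%:R * _%:R * _); lia.
have -> : ((n.+1 + j.+1) ^_ j.*2.+2)%:R
    = (n + j + 2)%:R * W * ((n.+1 + j)%:R - j.*2%:R).
  rewrite addnS ffactSS natrM natr_ffactSr mulrA; congr (_%:R * _ * _); lia.
have -> : ((n + j.+1) ^_ j.*2.+2)%:R
    = W * ((n.+1 + j)%:R - j.*2%:R) * ((n.+1 + j)%:R - j.*2.+1%:R).
  by rewrite addnS -addSn !natr_ffactSr.
rewrite -/W -![(n + j + _)%:R]/(_%:R) factS -!addnn.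
have -> : n.+2%:R = n%:R + 2 :> rat by rewrite -addn2 natrD.
have -> : n.+1%:R = n%:R + 1 :> rat by rewrite -natr1.
rewrite natrM !(natrD, mulrS, mulr0n, addSn).
have j0 : 1 + j%:R != 0 :> rat by rewrite -mulrS pnatr_eq0.
by field; rewrite j0 fact_neq0.
Qed.

Lemma natr_doubleS (A : pzSemiRingType) k : k.*2.+1%:R = 2 * k%:R + 1 :> A.
Proof. by rewrite -natr1 -muln2 natrM mulr_natr mulr_natl. Qed.

(** A continuous Hahn polynomial. Its image under [bern] is the integral over
  [0, 1] of the shifted Legendre polynomial \sum_k C(n, k) C(n + k, k) (-u)^k. *)
Definition padeQ n : {poly rat} :=
  \sum_(k < n.+1) pade_coef n k *: ffallr 'X k.

Lemma padeQ_wide N n : (n < N)%N ->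
  padeQ n = \sum_(k < N) pade_coef n k *: ffallr 'X k.
Proof.
move=> nN; rewrite /padeQ (big_ord_widen N (fun k => pade_coef n k *: ffallr 'X k) nN).
rewrite big_mkcond; apply: eq_bigr => i _; case: ltnP => // le.
by rewrite pade_coef_gt ?scale0r.
Qed.

Lemma padeQ_rec n :
  n.+2%:R ^+ 2 *: padeQ n.+2 =
  n.+1.*2.+1%:R *: ((2 *: 'X + 1) * padeQ n.+1) + n.+1%:R ^+ 2 *: padeQ n.
Proof.
have -> : (2 *: 'X + 1) * padeQ n.+1 = \sum_(k < n.+3)
   (k.*2.+1%:R * pade_coef n.+1 k
     + (if (k : nat) is j.+1 then 2 * pade_coef n.+1 j else 0)) *: ffallr 'X k.
  have Xf k : (2 *: 'X + 1) * ffallr 'X k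
            = 2 *: ffallr 'X k.+1 + k.*2.+1%:R *: ffallr ('X : {poly rat}) k.
    rewrite ffallrS -!mul_polyC -!natr_poly natr_doubleS; ring.
  transitivity (\sum_(k < n.+3) (k.*2.+1%:R * pade_coef n.+1 k) *: ffallr 'X k
     + \sum_(k < n.+2) (2 * pade_coef n.+1 k) *: ffallr ('X : {poly rat}) k.+1).
    rewrite big_ord_recr /= pade_coef_gt // mulr0 scale0r addr0.
    rewrite /padeQ mulr_sumr -big_split; apply: eq_bigr => k _ /=.
    by rewrite -scalerAr Xf scalerDr !scalerA addrC ![pade_coef _ _ * _]mulrC.
  rewrite [in RHS](eq_bigr _ (fun k _ => scalerDl _ _ _)) big_split /=.
  by rewrite [X in _ = _ + X]big_ord_recl scale0r add0r.
rewrite (@padeQ_wide n.+3 n.+2) // (@padeQ_wide n.+3 n); last lia.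
rewrite !scaler_sumr -big_split; apply: eq_bigr => -[[|j] jn] _ /=;
  rewrite !scalerA -scalerDl.
  congr (_ *: _); rewrite !pade_coef0 !natr_doubleS -!natr1; ring.
by rewrite pade_coef_rec.
Qed.

Lemma padeQ0 : padeQ 0 = 1.
Proof. by rewrite /padeQ big_ord1 pade_coef0 scale1r ffallr0. Qed.

Lemma bern_ffall k : bern (ffallr 'X k) = (-1) ^+ k * k`!%:R / k.+1%:R.
Proof.
by have := bern_fall_rise k 0; rewrite /frise big_ord0 fact0 !mulr1 addn0.
Qed.

(** The sum giving [bern (padeQ n)] is summable in closed form. Its value at
  K = n contains the vanishing falling factorial of 2n + 1 by 2n + 2. *)
Lemma bern_padeQ_partial n K :
  n%:R * n.+1%:R * \sum_(k < K.+1) pade_coef n k * bern (ffallr 'X k)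
  = (-1) ^+ K * ((n + K.+1) ^_ K.+1.*2)%:R / (K`!%:R * K.+1`!%:R).
Proof.
elim: K => [|K IH].
  rewrite big_ord1 pade_coef0 bern_ffall addn1 ffactSS ffactn1 natrM !factS.
  by rewrite fact0 muln1 /=; field.
rewrite big_ord_recr /= mulrDr {}IH bern_ffall pade_coefE.
set P := ((n + K.+1) ^_ K.+1.*2)%:R.
have -> : ((n + K.+2) ^_ K.+2.*2)%:R
    = (n + K.+2)%:R * (P * ((n + K.+1)%:R - K.+1.*2%:R)).
  by rewrite addnS doubleS ffactSS natrM natr_ffactSr.
rewrite !factS !natrM -addnn !natrD -[K.+2%:R]natr1 -[K.+1%:R]natr1 -[n.+1%:R]natr1.
have K1 : K%:R + 1 != 0 :> rat by rewrite natr1 pnatr_eq0.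
have K2 : K%:R + 1 + 1 != 0 :> rat by rewrite !natr1 pnatr_eq0.
rewrite [(-1) ^+ K.+1]exprS; move: ((-1) ^+ K) => e.
by field; rewrite fact_neq0 K1.
Qed.

Lemma bern_padeQ n : bern (padeQ n.+1) = 0.
Proof.
rewrite /padeQ raddf_sum /=; under eq_bigr => k _ do rewrite bernZ.
have n0 : n.+1%:R * n.+2%:R != 0 :> rat by rewrite -natrM pnatr_eq0.
apply: (mulfI n0); rewrite mulr0 bern_padeQ_partial.
by rewrite ffact_small ?mulr0 ?mul0r //; lia.
Qed.

(** Orthogonality. The recurrence expresses t Q_n by Q_(n-1), Q_n and Q_(n+1),
  which reduces the degree j to the case of [bern_padeQ]. *)
Lemma bern_padeQXn n j : (j < n)%N -> bern (padeQ n * 'X^j) = 0.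
Proof.
elim: j n => [|j IH] [|n] // jn; first by rewrite mulr1 bern_padeQ.
case: n jn => // n jn.
have c0 : n.+2.*2.+1%:R * 2 != 0 :> rat by rewrite mulf_neq0 ?pnatr_eq0.
apply: (mulfI c0); rewrite mulr0 -bernZ.
have -> : (n.+2.*2.+1%:R * 2) *: (padeQ n.+2 * 'X^(j.+1))
   = n.+3%:R ^+ 2 *: (padeQ n.+3 * 'X^j) - n.+2%:R ^+ 2 *: (padeQ n.+1 * 'X^j)
     - n.+2.*2.+1%:R *: (padeQ n.+2 * 'X^j).
  rewrite !scalerAl padeQ_rec exprS -!mul_polyC; ring.
by rewrite !raddfB /= !bernZ !IH ?mulr0 ?subr0 //; lia.
Qed.

(** * The p-adic size of the moments *)

Lemma padic_abs_sum p (I : Type) (s : seq I) (P : pred I) (f : I -> rat) B :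
  0 <= B -> (forall i, P i -> padic_abs p (f i) <= B) ->
  padic_abs p (\sum_(i <- s | P i) f i) <= B.
Proof.
move=> B0 fB; elim/big_rec: _ => [|i x Pi xB]; first by rewrite padic_abs0.
by apply: le_trans (padic_absD _ _ _) _; rewrite ge_max fB.
Qed.

Lemma padic_abs_natE p n : (0 < n)%N ->
  padic_abs p n%:R = (p ^ logn p n)%:R^-1.
Proof.
move=> n0; have n0' : n != 0%N by rewrite -lt0n.
rewrite /padic_abs pnatr_eq0 (negPf n0').
have -> : n%:R = n%:~R / 1%:~R :> rat by rewrite divr1.
by rewrite padic_val_frac //= logn1 subr0 -exprnN natrX.
Qed.

Lemma padic_abs_nat_le1 p n : padic_abs p n%:R <= 1.
Proof.
case: n => [|n]; first by rewrite padic_abs0.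
rewrite padic_abs_natE //.
have [pp|pN] := boolP (prime p); last by rewrite lognE (negPf pN) expn0 invr1.
by rewrite invf_le1 ?ler1n ?ltr0n ?expn_gt0 ?prime_gt0.
Qed.

Lemma padic_abs_int_le1 p (z : int) : padic_abs p z%:~R <= 1.
Proof.
case: z => n; first exact: padic_abs_nat_le1.
by rewrite NegzE mulrNz padic_absN padic_abs_nat_le1.
Qed.

Lemma padic_abs_natV_le p n : (0 < n)%N -> padic_abs p n%:R^-1 <= n%:R.
Proof.
move=> n0; rewrite padic_absV padic_abs_natE // invrK ler_nat.
by rewrite dvdn_leq // pfactor_dvdnn.
Qed.

Lemma padic_abs_fact_le p m n : (n <= m)%N ->
  padic_abs p m`!%:R <= padic_abs p n`!%:R.
Proof.
move=> nm; rewrite (fact_split nm) natrM padic_absM.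
by rewrite ler_piMr ?padic_abs_ge0 ?padic_abs_nat_le1.
Qed.

Lemma padeQ_frise_eq0 n j m : (j + m < n)%N ->
  bern (padeQ n * 'X^j * frise m) = 0.
Proof.
elim: m j => [|m IH] j jmn.
  by rewrite /frise big_ord0 mulr1 bern_padeQXn // -(addn0 j).
have -> : padeQ n * 'X^j * frise m.+1
    = padeQ n * 'X^(j.+1) * frise m + m.+1%:R *: (padeQ n * 'X^j * frise m).
  rewrite friseS exprS -mul_polyC -natr_poly; ring.
by rewrite raddfD /= bernZ !IH ?mulr0 ?addr0 //; lia.
Qed.

(** For j = 0 the moment is m! times an integral combination of the numbers
  1 / (k + m + 1) with k <= n, and it vanishes unless m >= n, when n! divides
  m!. The relation t [frise m] = [frise m.+1] - (m + 1) [frise m] then trades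
  powers of t for rising factorials, keeping integral coefficients. *)
Lemma padeQ_frise_bound p n j m :
  padic_abs p (bern (padeQ n * 'X^j * frise m))
    <= padic_abs p n`!%:R * (j + m + n).+1%:R.
Proof.
elim: j m => [|j IH] m; last first.
  have -> : padeQ n * 'X^(j.+1) * frise m
      = padeQ n * 'X^j * frise m.+1 - m.+1%:R *: (padeQ n * 'X^j * frise m).
    rewrite friseS exprS -mul_polyC -natr_poly; ring.
  rewrite raddfB /= bernZ (le_trans (padic_absD _ _ _)) // ge_max padic_absN.
  rewrite padic_absM; apply/andP; split.
    by apply: le_trans (IH _) _; rewrite addSnnS.
  apply: le_trans (_ : 1 * (padic_abs p n`!%:R * (j + m + n).+1%:R) <= _).
    by rewrite ler_pM ?padic_abs_ge0 ?padic_abs_nat_le1.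
  by rewrite mul1r ler_wpM2l ?padic_abs_ge0 ?ler_nat.
have B0 : 0 <= padic_abs p n`!%:R * (0 + m + n).+1%:R by rewrite mulr_ge0 ?padic_abs_ge0.
case: (ltnP m n) => mn; first by rewrite padeQ_frise_eq0 // padic_abs0.
rewrite mulr1 /padeQ mulr_suml raddf_sum /=; apply: padic_abs_sum => // k _.
rewrite -scalerAl bernZ bern_fall_rise /pade_coef.
have -> : ('C(n, k) * 'C(n + k, k))%:R / k`!%:R *
     ((-1) ^+ k * k`!%:R * m`!%:R / (k + m).+1%:R)
   = m`!%:R * ((-1) ^+ k * ('C(n, k) * 'C(n + k, k))%:R) / (k + m).+1%:R :> rat.
  by field; rewrite fact_neq0 andbT -natrD nat1r pnatr_eq0.
rewrite -mulrA padic_absM ler_pM ?padic_abs_ge0 ?padic_abs_fact_le //.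
rewrite padic_absM -[leRHS]mul1r ler_pM ?padic_abs_ge0 //.
  have -> : (-1) ^+ k * ('C(n, k) * 'C(n + k, k))%:R
      = ((-1) ^+ k * ('C(n, k) * 'C(n + k, k))%:Z)%:~R :> rat.
    by rewrite intrM rmorph_sign.
  exact: padic_abs_int_le1.
apply: le_trans (padic_abs_natV_le _ _) _ => //; rewrite ler_nat.
by have := ltn_ord k; lia.
Qed.

Lemma padeQXn_bound p n j :
  padic_abs p (bern (padeQ n * 'X^j)) <= padic_abs p n`!%:R * (j + n).+1%:R.
Proof.
by have := padeQ_frise_bound p n j 0; rewrite /frise big_ord0 mulr1 addn0.
Qed.

(** A weak form of the von Staudt-Clausen theorem, sufficient for the
  convergence of the series. *)
Lemma bernoulli_bound p j : padic_abs p (bernoulli j) <= j.+1%:R.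
Proof.
have := padeQXn_bound p 0 j.
by rewrite padeQ0 mul1r bernXn fact0 padic_abs1 mul1r addn0.
Qed.

(** * Numerators and denominators of the approximations *)

Lemma ffallrD (A : comPzRingType) (x z : A) k :
  ffallr (x + z) k = \sum_(i < k.+1) 'C(k, i)%:R * ffallr x i * ffallr z (k - i).
Proof.
elim: k => [|k IH]; first by rewrite big_ord1 !ffallr0 !mulr1.
rewrite ffallrS IH mulr_suml.
transitivity (\sum_(i < k.+1) ('C(k, i)%:R * ffallr x i * ffallr z (k - i).+1
                + 'C(k, i)%:R * ffallr x i.+1 * ffallr z (k - i))).
  apply: eq_bigr => i _; rewrite !ffallrS.
  have -> : k%:R = i%:R + (k - i)%:R :> A by rewrite -natrD subnKC // -ltnS.
  ring.
rewrite big_split /= [in RHS]big_ord_recl /= subn0 bin0.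
under [in RHS]eq_bigr => i _ do rewrite /bump add1n binS natrD !mulrDl subSS.
rewrite big_split /= addrA; congr (_ + _).
rewrite big_ord_recl [in RHS]big_ord_recr /= (@bin_small k k.+1) // !mul0r addr0 subn0 bin0.
congr (_ + _); apply: eq_bigr => i _; rewrite /bump add1n subnSK //.
Qed.

Lemma ffallrC (y : rat) k : ffallr y%:P k = (ffallr y k)%:P.
Proof.
by rewrite /ffallr rmorph_prod; apply: eq_bigr => i _; rewrite rmorphB /= rmorph_nat.
Qed.

(** The divided difference of the falling factorial at t and y, expanded by
  Vandermonde's identity at t = y + (t - y), since
  [ffallr s i.+1] = s [ffallr (s - 1) i]. In this form the denominators of its
  image under [bern] stay visible. *)
Definition ffall_dq (y : rat) k : {poly rat} :=
  \sum_(i < k) ('C(k, i.+1)%:R * ffallr y (k - i.+1)) *: ffallr ('X + (- y - 1)%:P) i.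

Lemma ffall_dqE y k :
  ('X - y%:P) * ffall_dq y k = ffallr 'X k - (ffallr y k)%:P.
Proof.
have {2}-> : 'X = ('X - y%:P) + y%:P :> {poly rat} by rewrite subrK.
rewrite ffallrD big_ord_recl /= bin0 ffallr0 !mul1r subn0 ffallrC addrAC subrr add0r.
rewrite /ffall_dq mulr_sumr; apply: eq_bigr => i _; rewrite ffallrS1 ffallrC.
rewrite rmorphB rmorphN /= -mul_polyC rmorphM /= -natr_poly addrA; ring.
Qed.

Definition binr (y : rat) k : rat := ffallr y k / k`!%:R.

Lemma bern_ffall_shift c i : bern (ffallr ('X + c%:P) i) / i`!%:R
  = \sum_(j < i.+1) (-1) ^+ j / j.+1%:R * binr c (i - j).
Proof.
rewrite ffallrD raddf_sum mulr_suml; apply: eq_bigr => j _ /=.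
have -> : 'C(i, j)%:R * ffallr 'X j * ffallr c%:P (i - j)
    = ('C(i, j)%:R * ffallr c (i - j)) *: ffallr ('X : {poly rat}) j.
  by rewrite ffallrC -mul_polyC rmorphM /= -natr_poly; ring.
rewrite bernZ bern_ffall /binr -(@bin_fact i j) 1?natrM; last by rewrite -ltnS.
have b0 : 'C(i, j)%:R != 0 :> rat by rewrite pnatr_eq0 -lt0n bin_gt0 -ltnS.
by field; rewrite b0 !fact_neq0 nat1r pnatr_eq0.
Qed.

Lemma bern_ffall_dq y k : bern (ffall_dq y k) / k`!%:R =
  \sum_(i < k) \sum_(j < i.+1)
    (-1) ^+ j / (i.+1%:R * j.+1%:R) * (binr y (k - i.+1) * binr (- y - 1) (i - j)).
Proof.
rewrite /ffall_dq raddf_sum mulr_suml; apply: eq_bigr => i _ /=.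
transitivity (binr y (k - i.+1) / i.+1%:R
    * (bern (ffallr ('X + (- y - 1)%:P) i) / i`!%:R)).
  rewrite bernZ /binr -(@bin_fact k i.+1) // factS !natrM.
  have b0 : 'C(k, i.+1)%:R != 0 :> rat by rewrite pnatr_eq0 -lt0n bin_gt0.
  by field; rewrite b0 !fact_neq0 nat1r pnatr_eq0.
rewrite bern_ffall_shift mulr_sumr; apply: eq_bigr => j _.
by field; rewrite !nat1r !pnatr_eq0.
Qed.

Definition pade_dq (y : rat) n : {poly rat} :=
  \sum_(k < n.+1) pade_coef n k *: ffall_dq y k.

Lemma pade_dqE y n : ('X - y%:P) * pade_dq y n = padeQ n - (padeQ n).[y]%:P.
Proof.
have -> : (padeQ n).[y] = \sum_(k < n.+1) pade_coef n k * ffallr y k.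
  rewrite /padeQ horner_sum; apply: eq_bigr => k _; rewrite hornerZ; congr (_ * _).
  rewrite /ffallr horner_prod; apply: eq_bigr => i _.
  by rewrite natr_poly !hornerE.
rewrite /pade_dq /padeQ mulr_sumr rmorph_sum -sumrB /=; apply: eq_bigr => k _.
by rewrite -scalerAr ffall_dqE scalerBr rmorphM /= mul_polyC.
Qed.

Definition pade_q (y : rat) n : rat := (padeQ n).[y].
Definition pade_p (y : rat) n : rat := bern (pade_dq y n).

Definition pade_recurrence (c : rat) (u : nat -> rat) := forall n,
  n.+2%:R ^+ 2 * u n.+2 = n.+1.*2.+1%:R * (c * u n.+1) + n.+1%:R ^+ 2 * u n.

Lemma pade_q_rec y : pade_recurrence (2 * y + 1) (pade_q y).
Proof.
move=> n; rewrite /pade_q -!hornerZ padeQ_rec.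
by rewrite !(hornerD, hornerZ, hornerM) hornerX hornerC.
Qed.

(** Dividing the recurrence of [padeQ] by t - y leaves the extra term
  2 (2n + 3) [padeQ n.+1], which [bern] annihilates. *)
Lemma pade_p_rec y : pade_recurrence (2 * y + 1) (pade_p y).
Proof.
move=> n; set c := 2 * y + 1.
have yX : 'X - y%:P != 0 :> {poly rat} by rewrite polyXsubC_eq0.
have E : n.+2%:R ^+ 2 *: pade_dq y n.+2 = n.+1.*2.+1%:R *: (c *: pade_dq y n.+1)
    + (n.+1.*2.+1%:R * 2) *: padeQ n.+1 + n.+1%:R ^+ 2 *: pade_dq y n.
  apply: (mulfI yX); rewrite !mulrDr -!scalerAr !pade_dqE.
  have := padeQ_rec n; have := pade_q_rec y n; rewrite /pade_q -/c.
  move: (n.+2%:R ^+ 2) (n.+1.*2.+1%:R) (n.+1%:R ^+ 2) => s2 d s1 Hq HQ.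
  rewrite scalerBr HQ -[s2 *: _%:P]mul_polyC -polyCM Hq -!mul_polyC /c.
  rewrite !(polyCD, polyCM); ring.
rewrite /pade_p -bernZ E !raddfD /= !bernZ bern_padeQ mulr0 addr0 //.
Qed.

Lemma pade_q0 y : pade_q y 0 = 1.
Proof. by rewrite /pade_q padeQ0 hornerC. Qed.

Lemma pade_p0 y : pade_p y 0 = 0.
Proof. by rewrite /pade_p /pade_dq big_ord1 /ffall_dq big_ord0 scaler0 raddf0. Qed.

Lemma pade_p1 y : pade_p y 1 = 2.
Proof.
rewrite /pade_p (_ : pade_dq y 1 = 2 *: 'X^0) ?bernZ ?bernXn ?bernoulli0 ?mulr1 //.
rewrite /pade_dq big_ord_recr big_ord1 /= /ffall_dq big_ord0 scaler0 add0r.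
by rewrite big_ord1 !ffallr0 scalerA /pade_coef !bin1 !factS fact0 /= mulr1 divr1.
Qed.

(** Up to sign, the recurrence multiplies the Casoratian by the square of
  (n + 1) / (n + 2). *)
Lemma casoratian_neq0 c u v : pade_recurrence c u -> pade_recurrence c v ->
  u 0%N * v 1%N != u 1%N * v 0%N -> forall n, u n * v n.+1 != u n.+1 * v n.
Proof.
move=> ru rv uv0; elim=> [//|n]; apply: contra_neq => E.
have n2 : n.+2%:R ^+ 2 != 0 :> rat by rewrite expf_neq0 ?pnatr_eq0.
have n1 : n.+1%:R ^+ 2 != 0 :> rat by rewrite expf_neq0 ?pnatr_eq0.
apply: (mulfI n1).
have := congr1 (fun t => n.+2%:R ^+ 2 * t) E; rewrite /= mulrCA rv [in RHS]mulrA ru.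
lra.
Qed.

Lemma bernoulli_ineq (R : realFieldType) (x : R) k : 0 <= x ->
  1 + k%:R * x <= (1 + x) ^+ k.
Proof.
move=> x0; elim: k => [|k IH]; first by rewrite mul0r addr0.
rewrite exprSr; apply: le_trans (ler_wpM2r _ IH); last by rewrite addr_ge0.
have : 0 <= k%:R * x * x by rewrite !mulr_ge0.
by rewrite -natr1; nra.
Qed.

(** The recurrence bounds u_(n+2) by 1 + 2 |c| / (n + 2) times the bound for
  the two previous terms, and this factor is at most ((n + 3) / (n + 2))^K for
  an integer K >= 2 |c|. *)
Lemma pade_recurrence_growth c u : pade_recurrence c u ->
  exists K : nat, forall n, `|u n| <= (`|u 0%N| + `|u 1%N|) * n.+1%:R ^+ K.
Proof.
move=> ru; pose K := (Num.truncn (2 * `|c|)).+1.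
have Kc : 2 * `|c| <= K%:R by apply: ltW; exact: truncnS_gt.
exists K; set A := `|_| + _.
have A0 : 0 <= A by rewrite addr_ge0.
suff H n : `|u n| <= A * n.+1%:R ^+ K /\ `|u n.+1| <= A * n.+2%:R ^+ K.
  by move=> n; case: (H n).
elim: n => [|n [IH1 IH2]].
  rewrite expr1n mulr1 /A lerDl normr_ge0; split=> //.
  apply: le_trans (_ : A * 1 <= _); first by rewrite mulr1 /A lerDr.
  by rewrite ler_wpM2l // exprn_ege1 // ler1n.
split=> //; set M := A * n.+2%:R ^+ K in IH2.
have M0 : 0 <= M by apply: le_trans IH2.
have {}IH1 : `|u n| <= M.
  by apply: le_trans IH1 _; rewrite ler_wpM2l // lerXn2r ?nnegrE // ler_nat.
have n2 : 0 < n.+2%:R :> rat by rewrite ltr0n.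
have step : n.+2%:R ^+ 2 * `|u n.+2|
    <= (n.+1.*2.+1%:R * `|c| + n.+1%:R ^+ 2) * M.
  have -> : n.+2%:R ^+ 2 * `|u n.+2| = `|n.+2%:R ^+ 2 * u n.+2|.
    by rewrite normrM ger0_norm // exprn_ge0.
  have n1 : 0 <= n.+1%:R ^+ 2 :> rat by rewrite exprn_ge0.
  rewrite ru (le_trans (ler_normD _ _)) // [leRHS]mulrDl lerD //.
    by rewrite normrM normr_nat normrM -mulrA !ler_wpM2l.
  by rewrite normrM (ger0_norm n1) ler_wpM2l.
have H : M * (1 + K%:R / n.+2%:R) <= A * n.+3%:R ^+ K.
  have -> : n.+3%:R = n.+2%:R * (1 + n.+2%:R^-1) :> rat.
    by rewrite mulrDr mulr1 divff ?gt_eqF // natr1.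
  rewrite exprMn mulrA ler_wpM2l // bernoulli_ineq // invr_ge0 ltW //.
apply: le_trans H; rewrite -(ler_pM2l (exprn_gt0 2 n2)).
apply: (le_trans step).
have -> : n.+2%:R ^+ 2 * (M * (1 + K%:R / n.+2%:R)) = (n.+2%:R ^+ 2 + n.+2%:R * K%:R) * M.
  by field; rewrite gt_eqF.
rewrite ler_wpM2r // natr_doubleS -[n.+2%:R]natr1.
have x0 : 0 <= n.+1%:R :> rat by [].
have y0 : 0 <= `|c| by [].
have := ler_wpM2l x0 Kc; nra.
Qed.

(** * Common denominators *)

Lemma binr_int F (c : int) l : (0 < F)%N ->
  (F ^ l * binom_den F l)%:R * binr (c%:~R / F%:R) l \is a Num.int.
Proof.
move=> F0; have [q Eq] := dvdzP (dvdz_prod_arith l c F0).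
have FR : F%:R != 0 :> rat by rewrite pnatr_eq0 -lt0n.
suff -> : (F ^ l * binom_den F l)%:R * binr (c%:~R / F%:R) l = q%:~R by exact: intr_int.
have E : F%:R ^+ l * ffallr (c%:~R / F%:R : rat) l
    = (\prod_(j < l) (c - j%:Z * F%:Z))%:~R.
  rewrite -[X in F%:R ^+ X](card_ord l) -prodr_const -big_split rmorph_prod /=.
  apply: eq_bigr => i _; rewrite mulrBr mulrC divfK // rmorphB rmorphM /= mulrC //.
rewrite /binr natrM natrX -mulrA mulrCA (mulrA (_ ^+ _)) E mulrA.
apply: (canLR (mulfK (fact_neq0 l))).
by have := congr1 (fun t : int => t%:~R : rat) Eq; rewrite !rmorphM.
Qed.

Definition pade_den F n := (F ^ n * binom_den F n * lcm_upto n ^ 2)%N.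

Lemma pade_den_gt0 F n : (0 < F)%N -> (0 < pade_den F n)%N.
Proof. by move=> F0; rewrite !muln_gt0 !expn_gt0 F0 binom_den_gt0 lcm_upto_gt0. Qed.

Lemma int_dvdn_mul (m n : nat) (x : rat) : (m %| n)%N ->
  m%:R * x \is a Num.int -> n%:R * x \is a Num.int.
Proof. by move=> /dvdnP[t ->] mx; rewrite natrM -mulrA rpredM // natr_int. Qed.

Lemma pade_q_sum y n : pade_q y n =
  \sum_(k < n.+1) ('C(n, k) * 'C(n + k, k))%:R * binr y k.
Proof.
rewrite /pade_q /padeQ horner_sum; apply: eq_bigr => k _.
rewrite hornerZ /pade_coef /binr -mulrA [_^-1 * _]mulrC; congr (_ * (_ / _)).
by rewrite /ffallr horner_prod; apply: eq_bigr => i _; rewrite natr_poly !hornerE.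
Qed.

Lemma pade_q_int F (c : int) n : (0 < F)%N ->
  (pade_den F n)%:R * pade_q (c%:~R / F%:R) n \is a Num.int.
Proof.
move=> F0; rewrite pade_q_sum mulr_sumr; apply: rpred_sum => k _.
rewrite mulrCA rpredM ?natr_int //; apply: int_dvdn_mul (binr_int c k F0).
have kn : (k <= n)%N by rewrite -ltnS.
by rewrite dvdn_mulr // dvdn_mul ?dvdn_exp2l ?binom_den_leq.
Qed.

(** In the expansion of [bern_ffall_dq], F^n [binom_den F n] clears the two
  binomial coefficients, whose lower indices have sum at most n, and each of
  i + 1 and j + 1 divides one factor lcm(1, ..., n). *)
Lemma pade_p_int F (c : int) n : (0 < F)%N ->
  (pade_den F n)%:R * pade_p (c%:~R / F%:R) n \is a Num.int.
Proof.
move=> F0; rewrite /pade_p /pade_dq raddf_sum mulr_sumr; apply: rpred_sum => k _ /=.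
have kn : (k <= n)%N by rewrite -ltnS.
rewrite bernZ /pade_coef -mulrA mulrCA rpredM ?natr_int // [_^-1 * _]mulrC.
rewrite bern_ffall_dq mulr_sumr; apply: rpred_sum => i _.
rewrite mulr_sumr; apply: rpred_sum => j _.
have ik := ltn_ord i; have ji := ltn_ord j.
set l := (k - i.+1)%N; set l' := (i - j)%N.
have -> : - (c%:~R / F%:R) - 1 = (- c - F%:Z)%:~R / F%:R :> rat.
  by rewrite rmorphB rmorphN /=; field; rewrite pnatr_eq0 -lt0n.
set x := binr _ l; set x' := binr _ l'.
have /dvdnP[t Et] : (F ^ l * binom_den F l * (F ^ l' * binom_den F l')
    %| F ^ n * binom_den F n)%N.
  have ln : (l + l' <= n)%N by lia.
  rewrite mulnACA -expnD dvdn_mul ?dvdn_exp2l //.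
  exact: dvdn_trans (binom_denD _ _ _) (binom_den_leq _ ln).
have /dvdnP[s Es] : (i.+1 %| lcm_upto n)%N by apply: dvdn_lcm_upto; lia.
have /dvdnP[s' Es'] : (j.+1 %| lcm_upto n)%N by apply: dvdn_lcm_upto; lia.
have -> : (pade_den F n)%:R * ((-1) ^+ j / (i.+1%:R * j.+1%:R) * (x * x'))
   = (-1) ^+ j * (s%:R * s'%:R * (t%:R *
     ((F ^ l * binom_den F l)%:R * x * ((F ^ l' * binom_den F l')%:R * x')))).
  rewrite /pade_den expnS expn1 {1}Es Es' Et !natrM.
  by field; rewrite !nat1r !pnatr_eq0.
rewrite rpredMsign; apply: rpredM; first by rewrite rpredM ?natr_int.
by apply: rpredM; rewrite ?natr_int // rpredM ?binr_int.
Qed.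

(** * The p-adic remainder *)

(** The truncated expansion of 1 / (t - y) at z = 1 / y, up to sign; its image
  under [bern] is a partial sum of the series defining R_p. *)
Definition geom_trunc (z : rat) N : {poly rat} := \sum_(j < N) z ^+ j.+1 *: 'X^j.

Lemma geom_truncE y N : y != 0 ->
  ('X - y%:P) * geom_trunc y^-1 N = (y^-1) ^+ N *: 'X^N - 1.
Proof.
move=> y0; elim: N => [|N IH].
  by rewrite /geom_trunc big_ord0 mulr0 expr0 scale1r subrr.
rewrite /geom_trunc big_ord_recr /= mulrDr -/(geom_trunc _ N) IH.
have -> : y^-1 ^+ N = y * y^-1 ^+ N.+1 by rewrite exprS mulrA divff ?mul1r.
by rewrite [X in _ = _ *: X - _]exprS -!mul_polyC rmorphM /=; ring.
Qed.

Lemma pade_remainder y n N : y != 0 ->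
  pade_q y n * (\sum_(j < N) bernoulli j * y^-1 ^+ j.+1) - pade_p y n
  = \sum_(j < N) y^-1 ^+ j.+1 * bern (padeQ n * 'X^j)
    - y^-1 ^+ N * bern (pade_dq y n * 'X^N).
Proof.
move=> y0.
have -> : \sum_(j < N) bernoulli j * y^-1 ^+ j.+1 = bern (geom_trunc y^-1 N).
  by rewrite /geom_trunc raddf_sum; apply: eq_bigr => j _; rewrite /= bernZ bernXn mulrC.
have -> : \sum_(j < N) y^-1 ^+ j.+1 * bern (padeQ n * 'X^j)
    = bern (padeQ n * geom_trunc y^-1 N).
  rewrite /geom_trunc mulr_sumr raddf_sum; apply: eq_bigr => j _ /=.
  by rewrite -scalerAr bernZ.
have -> : padeQ n * geom_trunc y^-1 N = pade_q y n *: geom_trunc y^-1 N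
    + y^-1 ^+ N *: (pade_dq y n * 'X^N) - pade_dq y n.
  have E : padeQ n = ('X - y%:P) * pade_dq y n + (pade_q y n)%:P.
    by rewrite pade_dqE subrK.
  rewrite {1}E mulrDl mulrAC geom_truncE // mulrBl mul1r -scalerAl mul_polyC.
  by rewrite ['X^N * _]mulrC addrC addrA.
by rewrite raddfB raddfD /= !bernZ /pade_p; ring.
Qed.

Lemma bern_mulXn_bound p (f : {poly rat}) N :
  padic_abs p (bern (f * 'X^N))
   <= (\sum_(i < size f) padic_abs p f`_i) * (N + size f)%:R.
Proof.
set C := \sum_(_ < _) _.
have fC (i : 'I_(size f)) : padic_abs p f`_i <= C.
  rewrite /C (bigD1 i) //= lerDl; apply: sumr_ge0 => j _; exact: padic_abs_ge0.
have C0 : 0 <= C by apply: sumr_ge0 => j _; exact: padic_abs_ge0.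
rewrite -{1}(coefK f) poly_def mulr_suml raddf_sum /=.
apply: padic_abs_sum => [|i _]; first by rewrite mulr_ge0.
rewrite -scalerAl bernZ -exprD bernXn padic_absM ler_pM ?padic_abs_ge0 //.
apply: le_trans (bernoulli_bound _ _) _; rewrite ler_nat.
by have := ltn_ord i; lia.
Qed.

Lemma padic_absX p (x : rat) n : padic_abs p (x ^+ n) = padic_abs p x ^+ n.
Proof.
elim: n => [|n IH]; first by rewrite !expr0 padic_abs1.
by rewrite !exprS padic_absM IH.
Qed.

(** The linear factor is absorbed since 2^N grows quadratically at least. *)
Lemma geom_small (R : archiRealFieldType) (t C e : R) (s : nat) :
  0 <= t <= 2^-1 -> 0 <= C -> 0 < e ->
  exists N0, forall N, (N0 <= N)%N -> C * (N + s)%:R * t ^+ N < e.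
Proof.
move=> /andP[t0 t2] C0 e0.
pose B := (2 * (Num.truncn (C / e)).+1 * s.+1)%N.
exists (4 * B)%N => N BN.
have CB : C * s.+1%:R * 2 <= B%:R * e.
  have h : C <= (Num.truncn (C / e)).+1%:R * e.
    by rewrite -ler_pdivrMr // ltW // truncnS_gt.
  rewrite /B !natrM; have s0 : 0 <= s.+1%:R :> R by [].
  by have := ler_wpM2r s0 h; lra.
have pow : (B * N.+1 < 2 ^ N)%N.
  have h : ((N./2).+1 * (N./2).+1 <= 2 ^ N)%N.
    apply: (@leq_trans (2 ^ N./2 * 2 ^ N./2)); first by rewrite leq_mul // ltn_expl.
    by rewrite -expnD leq_exp2l //; lia.
  by apply: leq_trans h; nia.
have tN : t ^+ N <= (2 ^ N)%:R^-1.
  rewrite natrX -exprVn; apply: lerXn2r; rewrite ?nnegrE ?invr_ge0 //.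
have pN : 0 < (2 ^ N)%:R :> R by rewrite ltr0n expn_gt0.
apply: le_lt_trans (_ : C * (N + s)%:R / (2 ^ N)%:R < _).
  by rewrite ler_wpM2l // mulr_ge0.
rewrite ltr_pdivrMr //.
apply: (@lt_le_trans _ _ (e * (B * N.+1).+1%:R)); last by rewrite ler_pM2l // ler_nat.
have : (N + s)%:R <= (s.+1 * N.+1)%:R :> R by rewrite ler_nat; nia.
move=> /(ler_wpM2l C0) h1; apply: (le_lt_trans h1).
have n0 : 0 <= N.+1%:R :> R by [].
have h2 := ler_wpM2r n0 CB.
have h3 : 0 <= C * s.+1%:R * N.+1%:R by rewrite !mulr_ge0.
rewrite -[(_ * _).+1%:R]natr1 natrM [(B * _)%:R]natrM; lra.
Qed.

Definition bern_partial (z : rat) N := \sum_(j < N) bernoulli j * z ^+ j.+1.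

Lemma linear_geom_decr (R : realFieldType) (t : R) n j :
  0 <= t <= 2^-1 -> (n <= j)%N ->
  (j + n).+1%:R * t ^+ j.+1 <= n.*2.+1%:R * t ^+ n.+1.
Proof.
move=> /andP[t0 t2] /subnKC <-; elim: (j - n)%N => [|i IH]; first by rewrite addn0 addnn.
apply: le_trans IH; rewrite addnS [in leLHS]exprS mulrA ler_wpM2r ?exprn_ge0 //.
have le2 : (n + i.+1 + n).+1%:R <= 2 * (n + i + n).+1%:R :> R.
  by rewrite -natrM ler_nat; lia.
have h0 : 0 <= (n + i.+1 + n).+1%:R :> R by [].
have := ler_wpM2l h0 t2; rewrite !addnS !addSn in le2 *; nra.
Qed.

(** The remainder is the limit of the expression in [pade_remainder]. Its first
  n terms vanish by orthogonality, the largest other term is the one with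
  j = n, and the term involving the divided difference tends to 0. *)
Lemma pade_remainder_bound p y n alpha :
  y != 0 -> padic_abs p y^-1 <= 2^-1 ->
  padic_null p (fun N => bern_partial y^-1 N - alpha) ->
  padic_abs p (pade_q y n * alpha - pade_p y n)
    <= padic_abs p n`!%:R * (n.*2.+1%:R * padic_abs p y^-1 ^+ n.+1).
Proof.
move=> y0 z2 Hnull; set E := leRHS.
have z0 : 0 < padic_abs p y^-1 by rewrite padic_abs_gt0 invr_eq0.
have E0 : 0 < E.
  apply: mulr_gt0; first by rewrite padic_abs_gt0 fact_neq0.
  by apply: mulr_gt0; rewrite ?ltr0n // exprn_gt0.
pose Q := padic_abs p (pade_q y n) + 1.
have Q0 : 0 < Q by rewrite ltr_wpDl ?padic_abs_ge0.
have [N1 H1] := Hnull (E / Q) (divr_gt0 E0 Q0).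
pose f := pade_dq y n.
have C0 : 0 <= \sum_(i < size f) padic_abs p f`_i.
  by apply: sumr_ge0 => i _; exact: padic_abs_ge0.
have zz : 0 <= padic_abs p y^-1 <= 2^-1 by rewrite padic_abs_ge0 z2.
have [N2 H2] := geom_small (size f) zz C0 E0.
pose N := maxn N1 N2.
have -> : pade_q y n * alpha - pade_p y n =
   (pade_q y n * bern_partial y^-1 N - pade_p y n)
   - pade_q y n * (bern_partial y^-1 N - alpha) by ring.
apply: le_trans (padic_absD _ _ _) _; rewrite padic_absN ge_max; apply/andP; split; last first.
  rewrite padic_absM -(divfK (lt0r_neq0 Q0) E) mulrC.
  apply: ler_pM; rewrite ?padic_abs_ge0 //; first by rewrite ltW // H1 // leq_maxl.
  by rewrite /Q lerDl.
rewrite /bern_partial pade_remainder //.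
apply: le_trans (padic_absD _ _ _) _; rewrite padic_absN ge_max; apply/andP; split.
  apply: padic_abs_sum => [|j _]; first exact: ltW.
  case: (ltnP j n) => jn; first by rewrite bern_padeQXn // mulr0 padic_abs0 ltW.
  rewrite padic_absM padic_absX.
  apply: le_trans (_ : padic_abs p y^-1 ^+ j.+1 * (padic_abs p n`!%:R * (j + n).+1%:R) <= _).
    by rewrite ler_wpM2l ?exprn_ge0 ?padic_abs_ge0 // padeQXn_bound.
  rewrite mulrCA ler_wpM2l ?padic_abs_ge0 // mulrC; exact: linear_geom_decr zz jn.
rewrite padic_absM padic_absX mulrC ltW //.
apply: le_lt_trans (H2 N (leq_maxr _ _)).
by rewrite ler_wpM2r ?exprn_ge0 ?padic_abs_ge0 // bern_mulXn_bound.
Qed.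

Lemma bern_partial_cauchy p z :
  padic_abs p z <= 2^-1 -> bern_partial z \in padic_cauchy p.
Proof.
move=> z2; apply/padic_cauchyP => e e0.
have zz : 0 <= padic_abs p z <= 2^-1 by rewrite padic_abs_ge0 z2.
have [N0 HN] := geom_small 1 zz ler01 e0.
exists N0.
have H m n : (N0 <= m)%N -> (m <= n)%N -> padic_abs p (bern_partial z n - bern_partial z m) < e.
  move=> Nm; elim: n => [|n IH].
    by rewrite leqn0 => /eqP ->; rewrite subrr padic_abs0.
  rewrite leq_eqVlt => /orP[/eqP ->|]; first by rewrite subrr padic_abs0.
  rewrite ltnS => mn; rewrite /bern_partial big_ord_recr /= -/(bern_partial _ n) addrAC.
  apply: padic_absD_lt; first exact: IH.
  have := HN n (leq_trans Nm mn); rewrite mul1r; apply: le_lt_trans.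
  rewrite padic_absM padic_absX addn1 exprS ler_pM ?padic_abs_ge0 ?bernoulli_bound //.
    by rewrite mulr_ge0 ?exprn_ge0 ?padic_abs_ge0.
  rewrite ler_piMl ?exprn_ge0 ?padic_abs_ge0 //; apply: le_trans z2 _; lra.
move=> m n Nm Nn; case: (leqP m n) => [mn|/ltnW nm]; last exact: H.
by rewrite padic_absB H.
Qed.

Lemma Qp_ratr_sum p (I : Type) (s : seq I) (P : pred I) (f : I -> rat) :
  ratr (\sum_(i <- s | P i) f i) = \sum_(i <- s | P i) (ratr (f i) : Qp p).
Proof.
apply: (big_morph (fun x : rat => ratr x : Qp p)) => [x y|].
  by rewrite !Qp_ratrE -rmorphD; congr Qp_class; apply: val_inj.
by rewrite Qp_ratrE -(rmorph0 (@Qp_class p)); congr Qp_class; apply: val_inj.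
Qed.

(** Equality with alpha in the completion says that the rational partial sums
  converge to alpha, so that the rest of the argument takes place among
  rational numbers. *)
Lemma Rp_rational_null (p : nat) (a : int) (F : nat) (alpha : rat) :
  padic_abs p (F%:R / a%:~R) <= 2^-1 -> Rp p a F = ratr alpha ->
  padic_null p (fun N => bern_partial ((- a)%:~R / F%:R)^-1 N - alpha).
Proof.
move=> z2; set y := _ / _.
have Ey : y^-1 = - (F%:R / a%:~R) by rewrite /y invf_div rmorphN invrN mulrN.
have z2' : padic_abs p y^-1 <= 2^-1 by rewrite Ey padic_absN.
pose u : padic_cauchy_seq p :=
  exist (fun v => v \in padic_cauchy p) _ (bern_partial_cauchy z2').
have Es : series (fun n => ratr (Rp_term a F n) : Qp p) = (fun n => ratr (val u n)).
  apply/funext => n; transitivity (ratr (bern_partial y^-1 n) : Qp p) => //.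
  rewrite /series /= big_mkord Qp_ratr_sum; apply: eq_bigr => i _.
  by rewrite /Rp_term Ey.
rewrite /Rp Es => E.
have H := @Qp_cvg_class p u.
have : Qp_class u = ratr alpha.
  by rewrite -E; apply/esym; apply: cvg_lim H; exact: metric_hausdorff.
by rewrite Qp_ratrE => /Qp_class_eq.
Qed.

Lemma ler1_norm_padic p (x : rat) : x \is a Num.int -> x != 0 ->
  1 <= `|x| * padic_abs p x.
Proof.
move=> /intrP[m ->] m0; have m0' : m != 0 by rewrite intr_eq0 in m0.
have mN : (0 < `|m|)%N by rewrite absz_gt0.
have -> : padic_abs p m%:~R = padic_abs p `|m|%N%:R.
  by case: m {m0 m0' mN} => n //; rewrite NegzE mulrNz padic_absN abszN.
rewrite padic_abs_natE // -intr_norm -abszE ler_pdivlMr.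
  by rewrite mul1r ler_nat dvdn_leq // pfactor_dvdnn.
rewrite ltr0n; have [pp|pN] := boolP (prime p); first by rewrite expn_gt0 prime_gt0.
by rewrite lognE (negPf pN).
Qed.

(** * Logarithmic estimates *)

(** The tangent to the logarithm at 1 / t. With t small, it shows that ln x is
  negligible compared to x. *)
Lemma ln_le_mulB (R : realType) (t x : R) : 0 < t -> 0 < x ->
  ln x <= t * x - 1 - ln t.
Proof.
move=> t0 x0; have tx0 : 0 < t * x by rewrite mulr_gt0.
have := @le_ln1Dx R (t * x - 1); rewrite addrCA subrr addr0 lnM ?posrE //.
by move=> h; have := h (ltac:(lra)); lra.
Qed.

Lemma ln_le_harmonic (R : realType) n :
  ln (n.+1%:R : R) <= \sum_(1 <= k < n.+1) k%:R^-1.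
Proof.
elim: n => [|n IH]; first by rewrite big_geq // ln1.
rewrite big_nat_recr //=.
have n0 : 0 < (n.+1%:R : R) by rewrite ltr0n.
have -> : n.+2%:R = n.+1%:R * (1 + n.+1%:R^-1) :> R.
  by rewrite mulrDr mulr1 divff ?gt_eqF // -natr1.
rewrite lnM ?posrE ?addr_gt0 ?invr_gt0 // lerD //.
by apply: le_ln1Dx; apply: lt_trans (_ : 0 < _); rewrite ?invr_gt0 // ltrN10.
Qed.

Lemma fact_le_expn n : (n`! <= n ^ n)%N.
Proof.
suff H k : (k <= n)%N -> (k`! <= n ^ k)%N by apply: H.
elim: k => // k IH kn; rewrite factS expnS leq_mul // IH //; exact: ltnW.
Qed.

Lemma natr_divn_ge (R : realFieldType) (n m : nat) : (0 < m)%N ->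
  n%:R / m%:R - 1 <= (n %/ m)%:R :> R.
Proof.
move=> m0; rewrite lerBlDr ler_pdivrMr ?ltr0n // natr1 -natrM ler_nat.
by rewrite ltnW // ltn_ceil.
Qed.

Lemma natr_divn_le (R : realFieldType) (n m : nat) : (0 < m)%N ->
  (n %/ m)%:R <= n%:R / m%:R :> R.
Proof.
by move=> m0; rewrite ler_pdivlMr ?ltr0n // -natrM ler_nat leq_trunc_div.
Qed.

Lemma ln_natr_ge0 (R : realType) n : 0 <= ln (n%:R : R).
Proof. by case: n => [|n]; [rewrite ln0|rewrite ln_ge0 // ler1n]. Qed.

Lemma ler_ln_nat (R : realType) m n : (0 < m)%N -> (m <= n)%N ->
  ln (m%:R : R) <= ln n%:R.
Proof.
move=> m0 mn; rewrite ler_ln ?posrE ?ltr0n ?ler_nat //; exact: leq_trans mn.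
Qed.

Lemma ln_natM (R : realType) m n : (0 < m)%N -> (0 < n)%N ->
  ln ((m * n)%:R : R) = ln m%:R + ln n%:R.
Proof. by move=> m0 n0; rewrite natrM lnM ?posrE ?ltr0n. Qed.

Lemma ln_natX (R : realType) m n : (0 < m)%N ->
  ln ((m ^ n)%:R : R) = n%:R * ln m%:R.
Proof. by move=> m0; rewrite natrX lnXn ?ltr0n // mulr_natl. Qed.

Lemma ln_nat_prod (R : realType) (I : eqType) (s : seq I) (f : I -> nat) :
  {in s, forall i, (0 < f i)%N} ->
  ln ((\prod_(i <- s) f i)%:R : R) = \sum_(i <- s) ln (f i)%:R.
Proof.
elim: s => [|i s IH] f0; first by rewrite !big_nil ln1.
have f0s : {in s, forall i, (0 < f i)%N}.
  by move=> j js; apply: f0; rewrite inE js orbT.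
rewrite !big_cons ln_natM ?IH ?f0 ?mem_head //.
by rewrite big_seq_cond; apply: prodn_cond_gt0 => j /andP[/f0s].
Qed.

(** Chebyshev's argument: if log lcm(1, ..., m) > (1 + e) m for all large m, then
  [fact_lcm_upto] gives log n! >= (1 + e) n log n - O(n), because the harmonic
  sum exceeds log n, which contradicts n! <= n^n. *)
Lemma ln_lcm_upto_frequently (R : realType) (e : R) (M : nat) : 0 < e ->
  exists2 n, (M <= n)%N & ln ((lcm_upto n)%:R : R) <= (1 + e) * n%:R.
Proof.
move=> e0; apply: contrapT => H.
pose m := M.+1.
have Hm n : (m <= n)%N -> (1 + e) * n%:R <= ln ((lcm_upto n)%:R : R).
  move=> mn; rewrite leNgt; apply/negP => /ltW h; apply: H; exists n => //.
  exact: ltnW.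
(* the contradiction will be e ln n <= (1 + e) (ln m + 1) *)
pose C : R := (1 + e) * (ln m%:R + 1) / e.
pose n := maxn m (Num.truncn (expR C)).+1.
have mn : (m <= n)%N by rewrite leq_maxl.
have n0 : (0 < n)%N by apply: leq_trans mn.
have Cn : C < ln n%:R.
  rewrite -[C]expRK ltr_ln ?posrE ?expR_gt0 ?ltr0n //.
  apply: lt_le_trans (truncnS_gt _) _; by rewrite ler_nat leq_maxr.
have up : ln (n`!%:R : R) <= n%:R * ln n%:R.
  by rewrite -ln_natX //; apply: ler_ln_nat; rewrite ?fact_gt0 ?fact_le_expn.
have lo : \sum_(1 <= k < (n %/ m).+1) (1 + e) * (n%:R / k%:R - 1) <= ln (n`!%:R : R).
  rewrite fact_lcm_upto ln_nat_prod => [|k _]; last exact: lcm_upto_gt0.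
  rewrite [leRHS](big_cat_nat _ (n := (n %/ m).+1)) //=; last by rewrite ltnS leq_div.
  rewrite -[leLHS]addr0 lerD //; last by apply: sumr_ge0 => k _; apply: ln_natr_ge0.
  rewrite !big_nat; apply: ler_sum => k /andP[k0 kn].
  apply: le_trans (Hm _ _); first by rewrite ler_pM2l ?natr_divn_ge // addr_gt0.
  by rewrite leq_divRL // mulnC -leq_divRL.
have low : (1 + e) * (n%:R * ln (n %/ m).+1%:R - n%:R) <= ln (n`!%:R : R).
  apply: le_trans lo; rewrite -mulr_sumr ler_pM2l ?addr_gt0 // sumrB -mulr_sumr.
  rewrite lerB //; first by rewrite ler_pM2l ?ltr0n // ln_le_harmonic.
  by rewrite sumr_const_nat subn1 ler_nat leq_div.
have lnq : ln (n%:R : R) - ln m%:R <= ln (n %/ m).+1%:R.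
  rewrite lerBlDr -ln_natM //; apply: ler_ln_nat => //.
  by rewrite ltnW // ltn_ceil.
have nR : 0 < (n%:R : R) by rewrite ltr0n.
have : (1 + e) * (n%:R * (ln n%:R - ln m%:R) - n%:R) <= n%:R * ln n%:R.
  apply: le_trans up; apply: le_trans low.
  by rewrite ler_pM2l ?addr_gt0 // lerD2r ler_pM2l.
move: Cn; rewrite ltr_pdivrMr //.
move: nR; move: (ln (n%:R : R)) (ln (m%:R : R)) => x y; move: (n%:R : R) => z.
move=> z0 h1 h2.
have : z * ((1 + e) * (x - y - 1)) <= z * x by lra.
by rewrite ler_pM2l //; nra.
Qed.

(** Both n / (p - 1) and the valuation of n! are n / (p - 1) up to O(log n), so
  the logarithm of the inequality reads n g <= 2 (log lcm(1, ..., n) - n) +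
  O(log n), where g > 0 is the gap in the hypothesis. Take n among the integers
  of [ln_lcm_upto_frequently] or their successors. *)
Lemma ln_growth_contradiction (R : realType) (p F r A K : nat) :
  prime p -> (0 < F)%N -> (0 < A)%N ->
  ln (F%:R : R) + \sum_(q <- primes F) ln (q%:R : R) / (q%:R - 1) + 2
        < 2 * r%:R * ln (p%:R : R) + 2 * (ln (p%:R : R) / (p%:R - 1)) ->
  (forall N, exists2 n, (N <= n <= N.+1)%N &
     (p ^ (2 * r * n + n %/ p.-1 + logn p n`!) <=
      A * n.+1 ^ K * (F ^ n * binom_den F n * lcm_upto n ^ 2))%N) -> False.
Proof.
move=> pp F0 A0; set s := \sum_(q <- _) _; set l := ln (F%:R : R).
set lp := ln (p%:R : R) => gap H.
have p1 := prime_gt1 pp; have p0 := prime_gt0 pp.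
have pR (q : nat) : (0 < q)%N -> q%:R - 1 = q.-1%:R :> R.
  by move=> q0; rewrite -{1}(prednK q0) -natr1 addrK.
have lp0 : 0 <= lp by exact: ln_natr_ge0.
set g := 2 * r%:R * lp + 2 * (lp / (p%:R - 1)) - (l + s + 2).
have g0 : 0 < g by rewrite subr_gt0.
have key n : (0 < n)%N ->
    (p ^ (2 * r * n + n %/ p.-1 + logn p n`!) <=
      A * n.+1 ^ K * (F ^ n * binom_den F n * lcm_upto n ^ 2))%N ->
    n%:R * (g + 2) <= ln (A%:R : R) + 2 * lp + (K%:R + 1) * ln n.+1%:R
                     + 2 * ln (lcm_upto n)%:R.
  move=> n0 h.
  have pX m : (0 < p ^ m)%N by rewrite expn_gt0 p0.
  have {h} := ler_ln_nat R (pX _) h.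
  rewrite !(ln_natM, ln_natX) ?(muln_gt0, expn_gt0) ?A0 ?F0 ?p0 ?binom_den_gt0 ?lcm_upto_gt0 //.
  rewrite -/l -/lp !natrD.
  have hs : ln (binom_den F n)%:R <= n%:R * s.
    rewrite ln_nat_prod; last first.
      by move=> q; rewrite mem_primes => /andP[/prime_gt0 q0 _]; rewrite expn_gt0 q0.
    rewrite mulr_sumr big_seq [leRHS]big_seq; apply: ler_sum => q.
    rewrite mem_primes => /and3P[qp _ _]; have q1 := prime_gt1 qp.
    rewrite ln_natX ?prime_gt0 // pR ?prime_gt0 // mulrA mulrAC.
    by rewrite ler_wpM2r ?ln_natr_ge0 ?natr_divn_le // ltn_predRL.
  have hT : (trunc_log p n)%:R * lp <= ln n.+1%:R.
    rewrite -ln_natX //; apply: ler_ln_nat; first by rewrite expn_gt0 p0.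
    by apply: leq_trans (trunc_logP p1 n0) _.
  have m0 : (0 < p.-1)%N by rewrite ltn_predRL.
  have hv : n%:R / (p%:R - 1) <= (logn p n`!)%:R + (trunc_log p n)%:R + 1 :> R.
    rewrite pR // ler_pdivrMr ?ltr0n // -natrD natr1 -natrM ler_nat mulnC -addnS.
    exact: logn_fact_lb.
  have hd := natr_divn_ge R n m0; rewrite -pR // in hd.
  have hv' := ler_wpM2r lp0 hv; have hd' := ler_wpM2r lp0 hd.
  move: hs hT hv' hd'; rewrite !natrM /g.
  by move: (_^-1) => i; lra.
(* the slope at which the K + 3 logarithms cost g / 4 per unit of n *)
have [t t0 Ht] : exists2 t : R, 0 < t & (K%:R + 3) * t = g / 4.
  exists (g / 4 / (K%:R + 3)); first by rewrite !divr_gt0 // ltr_wpDl.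
  by rewrite mulrC divfK // gt_eqF // ltr_wpDl.
pose C := ln (A%:R : R) + 2 * lp + g / 4 + (K%:R + 3) * (- 1 - ln t).
(* the excess 2 (g / 8) n over 2 n, with the g n / 4 above, uses half of g n *)
have [N Nlarge HN] :=
  ln_lcm_upto_frequently ((Num.truncn (C / (g / 2))).+2) (ltac:(lra) : 0 < g / 8).
have {H} [n /andP[Nn nN] Hn] := H N.
have n0 : (0 < n)%N by apply: leq_trans Nn; apply: leq_trans Nlarge.
have := key n n0 Hn.
have hd : ln (lcm_upto n)%:R <= (1 + g / 8) * n%:R + ln (n.+1%:R : R).
  have NnR : N%:R <= n%:R :> R by rewrite ler_nat.
  have hN : ln (lcm_upto N)%:R <= (1 + g / 8) * n%:R :> R.
    by apply: (le_trans HN); rewrite ler_pM2l // addr_gt0 // divr_gt0.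
  move: nN; rewrite leq_eqVlt => /orP[/eqP ->|nN].
    apply: le_trans (ler_ln_nat R (lcm_upto_gt0 _) (dvdn_leq _ (lcm_uptoS N))) _.
      by rewrite muln_gt0 lcm_upto_gt0.
    rewrite ln_natM ?lcm_upto_gt0 // addrC lerD //; last exact: ler_ln_nat.
    apply: (le_trans HN); rewrite ler_pM2l ?ler_nat //; by rewrite addr_gt0 // divr_gt0.
  have -> : n = N by apply/eqP; rewrite eqn_leq Nn -ltnS nN.
  by apply: (le_trans HN); rewrite lerDl ln_natr_ge0.
have hl : ln (n.+1%:R : R) <= t * n.+1%:R - 1 - ln t by apply: ln_le_mulB; rewrite ?ltr0n.
have hC : C < g / 2 * n%:R.
  rewrite mulrC -ltr_pdivrMr ?divr_gt0 //.
  apply: lt_le_trans (truncnS_gt _) _; rewrite ler_nat.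
  by apply: leq_trans Nn; apply: leq_trans Nlarge.
have K3 : 0 <= K%:R + 3 :> R by rewrite addr_ge0.
have := ler_wpM2l K3 hl.
have -> : (K%:R + 3) * (t * n.+1%:R - 1 - ln t)
         = g / 4 * n%:R + g / 4 + (K%:R + 3) * (- 1 - ln t).
  by rewrite -Ht -natr1; ring.
move: hC hd; rewrite /C.
lra.
Qed.

(** * Irrationality *)

(** A nat-valued bound, ready for comparison with the power of p. *)
Lemma pade_forms_growth y alpha : exists A K : nat, (0 < A)%N /\
  forall n, `|pade_q y n * alpha - pade_p y n| <= (A * n.+1 ^ K)%:R.
Proof.
have [K1 H1] := pade_recurrence_growth (pade_q_rec y).
have [K2 H2] := pade_recurrence_growth (pade_p_rec y).
move: H1 H2; set A1 := _ + _; set A2 := _ + _ => H1 H2.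
pose A := (Num.truncn (A1 * `|alpha| + A2)).+1.
exists A, (K1 + K2)%N; split=> // n.
have A10 : 0 <= A1 by rewrite addr_ge0.
have A20 : 0 <= A2 by rewrite addr_ge0.
have HA : A1 * `|alpha| + A2 <= A%:R by rewrite ltW // truncnS_gt.
have n1 : 1 <= n.+1%:R :> rat by rewrite ler1n.
have pow K : (K <= K1 + K2)%N -> n.+1%:R ^+ K <= n.+1%:R ^+ (K1 + K2) :> rat.
  by move=> h; rewrite ler_weXn2l.
rewrite natrM natrX; set T := n.+1%:R ^+ (K1 + K2).
have T0 : 0 <= T by rewrite exprn_ge0.
apply: (le_trans (ler_normB _ _)); rewrite normrM.
apply: le_trans (_ : (A1 * T) * `|alpha| + A2 * T <= _).
  apply: lerD; first apply: ler_wpM2r => //.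
    by apply: (le_trans (H1 n)); rewrite ler_wpM2l // pow ?leq_addr.
  by apply: (le_trans (H2 n)); rewrite ler_wpM2l // pow ?leq_addl.
by rewrite mulrAC -mulrDl ler_wpM2r.
Qed.

Lemma pade_forms_neq0 y alpha N : exists2 n, (N <= n <= N.+1)%N &
  pade_q y n * alpha - pade_p y n != 0.
Proof.
have [E|E] := eqVneq (pade_q y N * alpha - pade_p y N) 0; last first.
  by exists N; rewrite ?leqnn ?leqnSn.
exists N.+1; rewrite ?leqnn ?leqnSn //.
have c0 : pade_q y 0 * pade_p y 1 != pade_q y 1 * pade_p y 0.
  by rewrite pade_q0 pade_p1 pade_p0 mulr0 mul1r pnatr_eq0.
apply: contra (casoratian_neq0 (pade_q_rec y) (pade_p_rec y) c0 N).
move: E => /eqP; rewrite !subr_eq0 => /eqP <- /eqP <-; apply/eqP; ring.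
Qed.

Lemma padic_abs_pade_den p F n : prime p -> (0 < F)%N -> (p %| F)%N ->
  padic_abs p (pade_den F n)%:R
    <= (p ^ (logn p F * n + n %/ p.-1))%:R^-1.
Proof.
move=> pp F0 pF; rewrite padic_abs_natE ?pade_den_gt0 //.
rewrite lef_pV2 ?posrE ?ltr0n ?expn_gt0 ?prime_gt0 // ler_nat leq_exp2l ?prime_gt1 //.
rewrite /pade_den !lognM ?lognX ?muln_gt0 ?expn_gt0 ?F0 ?binom_den_gt0 ?lcm_upto_gt0 //.
by rewrite [logn p (binom_den F n)]logn_prod_primes mem_primes pp F0 pF mul1n mulnC leq_addr.
Qed.

(** Multiplied by the denominator of alpha and [pade_den F n], the form
  q_n alpha - p_n is an integer. When it is nonzero, its absolute value is at
  least the inverse of its p-adic absolute value. *)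
Lemma Rp_rational_ineq (p : nat) (a : int) (F : nat) (alpha : rat) :
  prime p -> ~~ (p%:Z %| a)%Z -> (0 < F)%N -> (p %| F)%N -> Rp p a F = ratr alpha ->
  exists A K : nat, (0 < A)%N /\
  forall N, exists2 n, (N <= n <= N.+1)%N &
    (p ^ (2 * logn p F * n + n %/ p.-1 + logn p n`!)
       <= A * n.+1 ^ K * (F ^ n * binom_den F n * lcm_upto n ^ 2))%N.
Proof.
move=> pp pa F0 pF HR.
have p0 := prime_gt0 pp; have p1 := prime_gt1 pp.
have a0 : a != 0 by apply: contraNneq pa => ->; rewrite dvdz0.
set r := logn p F.
have r0 : (0 < r)%N by rewrite logn_gt0 mem_primes pp F0 pF.
have absa : padic_abs p a%:~R = 1.
  rewrite /padic_abs intr_eq0 (negPf a0).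
  have := @padic_val_frac p a 1 a0 isT; rewrite divr1 logn1 subr0 => ->.
  by rewrite logn_coprime // prime_coprime // -dvdzE.
have absz : padic_abs p (F%:R / a%:~R) = (p ^ r)%:R^-1.
  by rewrite padic_absM padic_absV absa invr1 mulr1 padic_abs_natE.
have z2 : padic_abs p (F%:R / a%:~R) <= 2^-1.
  rewrite absz lef_pV2 ?posrE ?ltr0n ?expn_gt0 ?p0 // ler_nat.
  by apply: (leq_trans p1); rewrite -{1}(expn1 p) leq_exp2l.
have Hnull := Rp_rational_null z2 HR.
set y : rat := (- a)%:~R / F%:R in Hnull.
have Ez : padic_abs p y^-1 = padic_abs p (F%:R / a%:~R).
  by rewrite /y invf_div rmorphN invrN mulrN padic_absN.
have y0 : y != 0 by rewrite mulf_neq0 ?intr_eq0 ?oppr_eq0 // invr_eq0 pnatr_eq0 -lt0n.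
have z2' : padic_abs p y^-1 <= 2^-1 by rewrite Ez.
have [A [K [A0 HA]]] := pade_forms_growth y alpha.
pose b := `|denq alpha|%N.
have b0 : (0 < b)%N by rewrite absz_gt0 denq_neq0.
exists (b * A * 2)%N, K.+1; split; first by rewrite !muln_gt0 b0 A0.
move=> N; have [n nN ln0] := pade_forms_neq0 y alpha N; exists n => //.
set l := pade_q y n * alpha - pade_p y n in ln0.
pose G := pade_den F n; have G0 : (0 < G)%N by exact: pade_den_gt0.
have lint : (b * G)%:R * l \is a Num.int.
  have -> : (b * G)%:R * l = G%:R * pade_q y n * (b%:R * alpha) - b%:R * (G%:R * pade_p y n).
    by rewrite natrM /l; ring.
  have bal : b%:R * alpha \is a Num.int.
    have -> : b%:R = (denq alpha)%:~R :> rat by rewrite -absz_denq.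
    rewrite -{2}(divq_num_den alpha) mulrC divfK ?intr_int //.
    by rewrite intr_eq0 denq_neq0.
  by rewrite rpredB // rpredM ?natr_int ?pade_q_int ?pade_p_int.
have bGl0 : (b * G)%:R * l != 0 by rewrite mulf_neq0 // pnatr_eq0 -lt0n muln_gt0 b0.
have := ler1_norm_padic p lint bGl0.
rewrite normrM normr_nat !padic_absM natrM padic_absM => h.
have hl := pade_remainder_bound n y0 z2' Hnull.
rewrite -/l Ez absz padic_abs_natE ?fact_gt0 // in hl.
have hG := padic_abs_pade_den n pp F0 pF; rewrite -/r -/G in hG.
have hb := padic_abs_nat_le1 p b.
set e := (r * n + n %/ p.-1 + logn p n`! + r * n.+1)%N.
have pe0 : 0 < (p ^ e)%:R :> rat by rewrite ltr0n expn_gt0 p0.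
have hp : padic_abs p b%:R * padic_abs p G%:R * padic_abs p l <= n.*2.+1%:R / (p ^ e)%:R.
  have -> : n.*2.+1%:R / (p ^ e)%:R
      = 1 * (p ^ (r * n + n %/ p.-1))%:R^-1 *
        ((p ^ logn p n`!)%:R^-1 * (n.*2.+1%:R * (p ^ r)%:R^-1 ^+ n.+1)) :> rat.
    rewrite /e expnD expnD !natrM !invfM expnM [(_ ^ n.+1)%:R]natrX exprVn; ring.
  by apply: ler_pM; rewrite ?mulr_ge0 ?padic_abs_ge0 // ler_pM ?padic_abs_ge0.
have hn : `|l| <= (A * n.+1 ^ K)%:R := HA n.
have main : (p ^ e)%:R <= (b * G * (A * n.+1 ^ K) * n.*2.+1)%:R :> rat.
  rewrite -[leLHS]mul1r -ler_pdivlMr // natrM -mulrA.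
  apply: (le_trans h); apply: ler_pM; rewrite ?mulr_ge0 ?padic_abs_ge0 //.
  by rewrite !natrM -natrM -natrM ler_wpM2l // -natrM.
rewrite ler_nat in main.
apply: leq_trans (_ : p ^ e <= _)%N.
  by rewrite leq_exp2l // /e mulnS -mulnA; clear; lia.
apply: (leq_trans main); rewrite -/(pade_den F n) -/G expnS.
have : (n.*2.+1 <= 2 * n.+1)%N by rewrite mul2n doubleS.
move: (n.+1 ^ K)%N => T h1; have := leq_mul (leqnn (b * G * (A * T))) h1.
by move/leq_trans; apply; clear; lia.
Qed.

Theorem theorem9p2 (R : realType) (p : nat) (a : int) (F : nat) (r : int)
    (p_prime : prime p)
    (p_ndvd_a : ~~ (p%:Z %| a)%Z)
    (F_gt0 : (0 < F)%N)
    (p_dvd_F : (p %| F)%N)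
    (r_def : padic_abs p F%:R = p%:R ^ (- r))
    (log_ineq :
      ln (F%:R : R) + \sum_(q <- primes F) ln (q%:R : R) / (q%:R - 1) + 2
        < 2 * r%:~R * ln (p%:R : R) + 2 * (ln (p%:R : R) / (p%:R - 1))) :
  ([set: Qp p] `\` range (ratr : rat -> Qp p)) (Rp p a F).
Proof.
split=> // -[alpha _ /esym HR].
have [A [K [A0 H]]] := Rp_rational_ineq p_prime p_ndvd_a F_gt0 p_dvd_F HR.
apply: (ln_growth_contradiction (R := R) p_prime F_gt0 A0 _ H).
suff -> : (logn p F)%:R = r%:~R :> R by [].
have p1 : 1 < p%:R :> rat by rewrite ltr1n prime_gt1.
have pp0 : 0 < p%:R :> rat by apply: lt_trans p1.
move: r_def; rewrite padic_abs_natE // natrX exprnN.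
move=> /(ieexprIz pp0 (negbT (gt_eqF p1)))/oppr_inj.
by move=> <-.
Qed.
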